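(* Let $\alpha,\beta\in(0,1)$, $\sigma>0$, let $n$ be an even positive integer, $\bar n=n/2$, $\mathcal{C}_{\bar n}=\{[i/\bar n,j/\bar n]: i<j\text{ in }\{0,\dots,\bar n\}\}$, and let $T_n^{\mathrm{reg}}$ be the test that rejects $H_0: f\in\mathcal{D}$ when $\max_{I\in\mathcal{C}_{\bar n}}\hat S_{\bar n}^{\mathrm{reg},I}>r_{\alpha,n}$. Let $L>0$, $s\in(0,2]$ and $R>0$, and assume $n\ge18\log(2/\alpha)$. In case $s\in(0,1]$, assume that $R/\sigma\le n^s$; in case $s\in(1,2]$, assume that $L/\sigma\le n$, $\bar n^s\sqrt{\log\bar n}\ge3^{s+1/2}R/\sigma$ and $R/\sigma\ge2^{1+2s}\sqrt{(\log\bar n)/\bar n}$. Then there exists a positive real $C(s,\alpha,\beta)$, only depending on $s$, $\alpha$ and $\beta$, such that in case $s\in(0,1]$, $$\rho\bigl(T_n^{\mathrm{reg}},\mathcal{F}(s,R),\Delta_1\bigr)\le C(s,\alpha,\beta)R^{1/(1+2s)}\Bigl(\frac{\sigma^2\log n}{n}\Bigr)^{s/(1+2s)}$$ and, in case $s\in(1,2]$, $$\rho\bigl(T_n^{\mathrm{reg}},\mathcal{F}(s,R,L),\Delta_1\bigr)\le C(s,\alpha,\beta)R^{1/(1+2s)}\Bigl(\frac{\sigma^2\log n}{n}\Bigr)^{s/(1+2s)}$$ and $$\rho\bigl(T_n^{\mathrm{reg}},\mathcal{F}(s,R,L),\Delta_2\bigr)\le C(s,\alpha,\beta)R^{3/(1+2s)}\Bigl(\frac{\sigma^2\log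 n}{n}\Bigr)^{(s-1)/(1+2s)}.$$
   Context: Regression model: one observes $Y_i=f(i/n)+\sigma\epsilon_i$, $i=1,\dots,n$, where $f:[0,1]\to\mathbb{R}$ and $\sigma>0$ are unknown and $\epsilon_1,\dots,\epsilon_n$ are independent standard Gaussian variables; $n$ is even and $\bar n=n/2$. $\mathbb{P}_f$ denotes probability when the regression function is $f$. Define, for $i=1,\dots,\bar n$, $\bar Y_i=(Y_{2i-1}+Y_{2i})/2$ and $\bar\epsilon_i=(\epsilon_{2i-1}+\epsilon_{2i})/\sqrt2$, and $$\hat\sigma^2=\frac1n\sum_{i=1}^{n/2}(Y_{2i}-Y_{2i-1})^2,\qquad \hat\sigma_0^2=\hat\sigma^2/2 .$$ The cumulative sum diagram (with equal weights $1/\bar n$) of points $z_1,\dots,z_{\bar n}$ is the continuous piecewise linear function on $[0,1]$ interpolating the points $\bigl(j/\bar n,\frac1{\bar n}\sum_{i=1}^j z_i\bigr)$, $j=0,\dots,\bar n$. Let $F^{\mathrm{reg}}_{\bar n}$ be the cumulative sum diagram of $\bar Y_1,\dots,\bar Y_{\bar n}$ and $G_{\bar n}$ that of $\bar\epsilon_1,\dots,\bar\epsilon_{\bar n}$. For a continuous function $G:[0,1]\to\mathbb{R}$ and a closed sub-interval $I$, $\hat G^I$ denotes the least concave majorant of the restriction of $G$ to $I$; $|I|$ is the length of $I$. Set $$\hat S^{\mathrm{reg},I}_{\bar n}=\sqrt{\frac{\bar n}{\hat\sigma_0^2|I|}}\,\sup_{t\in I}\Bigl(\widehat{F^{\mathrm{reg}}_{\bar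 n}}^{I}(t)-F^{\mathrm{reg}}_{\bar n}(t)\Bigr),\qquad Z_n^{\mathrm{reg}}=\max_{I\in\mathcal{C}_{\bar n}}\sqrt{\frac{\bar n}{|I|}}\,\sup_{t\in I}\bigl(\hat G_{\bar n}^I(t)-G_{\bar n}(t)\bigr).$$ The threshold $r_{\alpha,n}$ is the $(1-\alpha)$-quantile of $Z_n^{\mathrm{reg}}/\sqrt{\chi^2(\bar n)/\bar n}$, where $\chi^2(\bar n)$ is a random variable independent of $Z_n^{\mathrm{reg}}$ having the chi-square distribution with $\bar n$ degrees of freedom. $\mathcal{D}$ is the set of non-increasing functions from $[0,1]$ to $\mathbb{R}$. Hölder classes: for $R>0$ and $s\in(0,1]$, $\mathcal{F}(s,R)$ is the set of functions $f:[0,1]\to\mathbb{R}$ with $|f(u)-f(v)|\le R|u-v|^s$ for all $u,v\in[0,1]$; for $R>0$ and $s\in(1,2]$, $\mathcal{F}(s,R)$ is the set of differentiable functions $f:[0,1]\to\mathbb{R}$ with $f'\in\mathcal{F}(s-1,R)$. For $s\in(1,2]$, $R>0$, $L>0$, $\mathcal{F}(s,R,L)=\{f\in\mathcal{F}(s,R):\|f'\|_\infty\le L\}$. Criteria: $\Delta_1(f)=\inf_{g\in\mathcal{D}}\sup_{t\in[0,1]}|f(t)-g(t)|$ and, for differentiable $f$, $\Delta_2(f)=\sup_{t\in[0,1]}f'(t)$. Uniform separation rate of a test $\Phi$ over a class $\mathcal{F}$ with respect to $\Delta$: $$\rho(\Phi,\mathcal{F},\Delta)=\inf\bigl\{\rho>0:\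 \mathbb{P}_f(\Phi\text{ rejects }H_0)\ge1-\beta\ \text{ for all } f\in\mathcal{F}\text{ such that }\Delta(f)\ge\rho\bigr\}.$$ *)

(* Defs.v *)
From HB Require Import structures.
From mathcomp Require Import all_boot all_order all_algebra.
From mathcomp Require Import all_classical all_reals all_analysis.

Set Implicit Arguments.
Unset Strict Implicit.
Unset Printing Implicit Defensive.

Import Order.TTheory GRing.Theory Num.Theory.
Import numFieldNormedType.Exports.

Local Open Scope classical_set_scope.
Local Open Scope ring_scope.

(* Functions on [0, 1] are total functions [R -> R] of which only the values on
   [0, 1] are used.  Finite families (Y_1, .., Y_n) are functions [nat -> R] of
   which only the values at 1, .., n are used. *)

Definition mutually_independent (R : realType) (d : measure_display)
    (T : measurableType d) (P : probability T R) (n : nat)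
    (X : nat -> T -> R) : Prop :=
  forall (J : pred nat) (B : nat -> set R), (forall i, measurable (B i)) ->
    P (\bigcap_(i in [set i | (1 <= i <= n)%N && J i]) (X i @^-1` B i)) =
    (\prod_(1 <= i < n.+1 | J i) P (X i @^-1` B i))%E.

Definition independent2 (R : realType) (d : measure_display)
    (T : measurableType d) (P : probability T R) (X Y : T -> R) : Prop :=
  forall A B : set R, measurable A -> measurable B ->
    P (X @^-1` A `&` Y @^-1` B) = (P (X @^-1` A) * P (Y @^-1` B))%E.

Definition iid_standard_gaussian (R : realType) (d : measure_display)
    (T : measurableType d) (P : probability T R) (n : nat)
    (eps : nat -> {RV P >-> R}) : Prop :=
  mutually_independent P n eps /\
  forall i, (1 <= i <= n)%N -> forall A : set R, measurable A ->
    distribution P (eps i) A = normal_prob 0 1 A.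

Definition Gamma (R : realType) (a : R) : R :=
  \int[lebesgue_measure]_(x in `]0, +oo[) (x `^ (a - 1) * expR (- x)).

Definition chi_square_pdf (R : realType) (k : nat) (x : R) : R :=
  if 0 < x then
    x `^ (k%:R / 2 - 1) * expR (- x / 2) / (2 `^ (k%:R / 2) * Gamma (k%:R / 2))
  else 0.

Definition has_chi_square_law (R : realType) (d : measure_display)
    (T : measurableType d) (P : probability T R) (k : nat)
    (X : {RV P >-> R}) : Prop :=
  forall A : set R, measurable A ->
    distribution P X A =
    (\int[lebesgue_measure]_(x in A) (chi_square_pdf k x)%:E)%E.

Definition quantile (R : realType) (d : measure_display)
    (T : measurableType d) (P : probability T R) (X : T -> R) (p : R) : R :=
  inf [set x : R | (p%:E <= P [set w | X w <= x]%R)%E].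

(* On [j/m, (j+1)/m], where j = truncn (m * t), this is the affine function
   through (j/m, (z_1 + .. + z_j)/m) and ((j+1)/m, (z_1 + .. + z_(j+1))/m).
   At t = 1 the coefficient of z_(m+1) is 0. *)
Definition cusum (R : realType) (m : nat) (z : nat -> R) (t : R) : R :=
  let j := Num.truncn (m%:R * t) in
  m%:R^-1 * (\sum_(1 <= i < j.+1) z i + (m%:R * t - j%:R) * z j.+1).

Definition concave_on (R : realType) (a b : R) (h : R -> R) : Prop :=
  @convex_function R R^o [set` `[a, b]] (\- h).

Definition least_concave_majorant (R : realType) (a b : R) (G : R -> R) (t : R) : R :=
  inf [set h t | h in [set h : R -> R | concave_on a b h /\
                         forall u, u \in `[a, b] -> G u <= h u]].

Definition sup_gap (R : realType) (a b : R) (G : R -> R) : R :=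
  sup [set least_concave_majorant a b G t - G t | t in `[a, b]].

(* The maximum of S over the collection of the intervals [i/m, j/m], where
   0 <= i < j <= m.  It is only used for nonnegative S, so that the default
   value 0 plays no role. *)
Definition max_grid (R : realType) (m : nat) (S : R -> R -> R) : R :=
  \big[Num.max/0]_(ij : 'I_m.+1 * 'I_m.+1 | (ij.1 < ij.2)%N)
    S (ij.1%:R / m%:R) (ij.2%:R / m%:R).

(* Below, the sample size is n and there are n./2 averaged observations. *)
Definition Ybar (R : realType) (Y : nat -> R) (i : nat) : R :=
  (Y (2 * i).-1%N + Y (2 * i)%N) / 2.

Definition epsbar (R : realType) (eps : nat -> R) (i : nat) : R :=
  (eps (2 * i).-1%N + eps (2 * i)%N) / Num.sqrt 2.

Definition sigma2_hat (R : realType) (n : nat) (Y : nat -> R) : R :=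
  n%:R^-1 * \sum_(1 <= i < n./2.+1) (Y (2 * i)%N - Y (2 * i).-1%N) ^+ 2.

Definition sigma02_hat (R : realType) (n : nat) (Y : nat -> R) : R :=
  sigma2_hat n Y / 2.

Definition S_reg (R : realType) (n : nat) (Y : nat -> R) (a b : R) : R :=
  Num.sqrt (n./2%:R / (sigma02_hat n Y * (b - a))) *
  sup_gap a b (cusum n./2 (Ybar Y)).

Definition Z_reg (R : realType) (n : nat) (eps : nat -> R) : R :=
  max_grid n./2 (fun a b =>
    Num.sqrt (n./2%:R / (b - a)) * sup_gap a b (cusum n./2 (epsbar eps))).

(* eps_1, .., eps_n are meant to be independent standard Gaussian variables,
   and X a chi-square variable with n./2 degrees of freedom independent of
   Z_reg; the result depends only on the joint law of Z_reg and X. *)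
Definition threshold (R : realType) (d : measure_display)
    (T : measurableType d) (P : probability T R) (n : nat)
    (eps : nat -> T -> R) (X : T -> R) (alpha : R) : R :=
  quantile P (fun w => Z_reg n (eps ^~ w) / Num.sqrt (X w / n./2%:R))
    (1 - alpha).

Definition T_reg (R : realType) (n : nat) (r : R) : set (nat -> R) :=
  [set Y | r < max_grid n./2 (S_reg n Y)].

Definition nonincreasing01 (R : realType) : set (R -> R) :=
  [set f | {in `[0, 1] &, nonincreasing_fun f}].

(* difference quotients are restricted to [0, 1], so that derivatives at 0 and
   1 are one-sided *)
Definition diff_quot01 (R : realType) (f : R -> R) (x : R) : set_system R :=
  (f y - f x) / (y - x) @[y --> within `[0, 1] x^'].

Definition differentiable01 (R : realType) (f : R -> R) : Prop :=
  forall x, x \in `[0, 1] -> cvg (diff_quot01 f x).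

Definition derive01 (R : realType) (f : R -> R) (x : R) : R :=
  lim (diff_quot01 f x).

Definition holder_ball (R : realType) (s rad : R) : set (R -> R) :=
  [set f | forall u v, u \in `[0, 1] -> v \in `[0, 1] ->
             `|f u - f v| <= rad * `|u - v| `^ s].

Definition holder_class (R : realType) (s rad : R) : set (R -> R) :=
  if s <= 1 then holder_ball s rad
  else [set f | differentiable01 f /\ holder_ball (s - 1) rad (derive01 f)].

Definition sup_norm01 (R : realType) (f : R -> R) : \bar R :=
  ereal_sup [set `|f t|%:E | t in `[0, 1]].

Definition holder_class_bdd (R : realType) (s rad L : R) : set (R -> R) :=
  [set f | holder_class s rad f /\ (sup_norm01 (derive01 f) <= L%:E)%E].

Definition Delta1 (R : realType) (f : R -> R) : \bar R :=
  ereal_inf [set sup_norm01 (f \- g) | g in @nonincreasing01 R].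

Definition Delta2 (R : realType) (f : R -> R) : \bar R :=
  ereal_sup [set (derive01 f t)%:E | t in `[0, 1]].

Definition reg_obs (R : realType) (n : nat) (sigma : R) (f : R -> R)
    (eps : nat -> R) (i : nat) : R :=
  f (i%:R / n%:R) + sigma * eps i.

Definition reject_prob (R : realType) (d : measure_display)
    (T : measurableType d) (P : probability T R) (n : nat)
    (eps : nat -> T -> R) (sigma : R) (f : R -> R)
    (Phi : set (nat -> R)) : \bar R :=
  P [set w | Phi (reg_obs n sigma f (eps ^~ w))].

(* The infimum of the empty set is +oo. *)
Definition separation_rate (R : realType) (d : measure_display)
    (T : measurableType d) (P : probability T R) (n : nat)
    (eps : nat -> T -> R) (sigma beta : R) (Phi : set (nat -> R))
    (F : set (R -> R)) (Delta : (R -> R) -> \bar R) : \bar R :=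
  ereal_inf [set rho%:E | rho in [set rho : R | 0 < rho /\
    forall f, F f -> (rho%:E <= Delta f)%E ->
      ((1 - beta)%:E <= reject_prob P n eps sigma f Phi)%E]].

(* Main.v *)
Require Import Defs.
From HB Require Import structures.
From mathcomp Require Import all_boot all_order all_algebra.
From mathcomp Require Import all_classical all_reals all_analysis.
From mathcomp Require Import measurable_realfun.
From mathcomp Require Import lra zify.

Set Implicit Arguments.
Unset Strict Implicit.
Unset Printing Implicit Defensive.

Import Order.TTheory GRing.Theory Num.Theory.
Import numFieldNormedType.Exports.

Local Open Scope classical_set_scope.
Local Open Scope ring_scope.

(** The test compares the cumulative sum diagram of the averaged observations
    with its least concave majorant. Since the majorant lies above every chord,
    the statistic of the interval from i to j is at least the normalised height
    of the chord from i to j above the diagram at an intermediate point k, the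
    chord gap. The chord gap of the data is that of the signal plus that of the
    noise, and the latter is uniformly at most sigma sqrt (j - i) times a
    multiple of sqrt (ln n): normalised block sums of the noise are Gaussian and
    there are fewer than n^2 of them ([noise_fluctuation]). The threshold has the
    same order ([threshold_le]), because it is a quantile of a statistic built on
    pure noise divided by a chi-square variable that is rarely small, and the
    variance estimate is at most a constant times sigma^2 because increments of
    the signal between successive design points are at most sigma. Hence the
    test rejects with the required probability as soon as the signal has one
    chord gap above tau sqrt (j - i), where tau is a constant times
    sigma sqrt (ln n) ([reject_prob_ge]).

    The rest is a statement on functions: if all chord gaps of f are at most
    tau sqrt (j - i), then f rises little. The mean of f over a window changes,
    when the window is enlarged, by a chord gap divided by the length of the
    window; doubling the windows and summing a geometric series
    ([mean_chaining]), the means over two windows of width w differ upwards by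
    at most a multiple of tau / sqrt (n w), wherever the windows are
    ([level_rise_le]).

    A function with Delta1 f >= rho rises by rho / 2 somewhere, because
    t |-> sup of f on [t, 1] is nonincreasing ([Delta1_rise]). Let h be the
    bandwidth with rad h^s sqrt (n h) = sigma sqrt (ln n), so that g = rad h^s and
    g / h are the two rates. If s <= 1, the oscillation of f at scale h is of
    order g, so a rise by a large multiple of g would be seen on windows of width
    h at its two ends ([rough_not_small]). If s > 1, a slope much larger than
    g / h at one point persists at scale h by the Hoelder condition on the
    derivative and would be seen there ([slope_not_small]): this is the bound for
    Delta2. When the slope is at most of order g / h, the function cannot rise by
    more than a multiple of g over a width h, and the argument for s <= 1 applies
    to Delta1 ([smooth_not_small]). *)

(** * Chord gaps and chaining of local means *)

Definition partial_sum (R : realType) (z : nat -> R) (k : nat) : R :=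
  \sum_(1 <= l < k.+1) z l.

(** The height at k of the chord joining the points of index i and j of the
    graph of S, above that graph. The least concave majorant lies above every
    chord, so this is a lower bound for its distance to S. *)
Definition chord_gap (R : realType) (S : nat -> R) (i k j : nat) : R :=
  ((j%:R - k%:R) * S i + (k%:R - i%:R) * S j) / (j%:R - i%:R) - S k.

(** Enlarging the window on which S is averaged from q to N cells changes the
    mean increment by a chord gap divided by q: this turns bounds on chord gaps
    into bounds on variations of local means. *)
Lemma mean_increment (R : realType) (S : nat -> R) (i q N : nat) :
  (0 < q)%N -> (0 < N)%N ->
  (S (i + N)%N - S i) / N%:R =
  (S (i + q)%N - S i) / q%:R + chord_gap S i (i + q) (i + N) / q%:R.
Proof.
move=> q0 N0; rewrite /chord_gap !natrD.
have : (q%:R : R) != 0 by rewrite pnatr_eq0 -lt0n.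
have : (N%:R : R) != 0 by rewrite pnatr_eq0 -lt0n.
move=> /mulfV hN /mulfV hq.
set a := S i; set b := S (i + N)%N; set c := S (i + q)%N.
move: hN hq; set x := N%:R; set y := q%:R; set u := x^-1; set v := y^-1.
move=> hN hq.
have -> : i%:R + x - i%:R = x by lra.
have -> : i%:R + x - (i%:R + y) = x - y by lra.
have -> : i%:R + y - i%:R = y by lra.
rewrite -/u.
have e1 : x * u * (a * v) = a * v by rewrite hN mul1r.
have e2 : y * v * ((b - a) * u) = (b - a) * u by rewrite hq mul1r.
lra.
Qed.

(** Halving the window repeatedly, from N cells down to p, the changes of the
    mean form a geometric series dominated by its last terms, of order
    tau / sqrt p. The term in 1 / sqrt N is what makes the induction close. *)
Lemma mean_chaining (R : realType) (S : nat -> R) (tau : R) (i p N : nat) :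
  0 <= tau -> (0 < p <= N)%N ->
  (forall k j, (i < k < j)%N -> (j <= i + N)%N ->
     chord_gap S i k j <= tau * Num.sqrt (j - i)%:R) ->
  (S (i + N)%N - S i) / N%:R <=
  (S (i + p)%N - S i) / p%:R + tau * (12 / Num.sqrt p%:R - 10 / Num.sqrt N%:R).
Proof.
move=> tau0 /andP[p0 pN] H.
have [M MN] : exists M, (N <= M)%N by exists N.
elim: M N pN MN H => [|M IH] N pN MN H; first by lia.
have sqp (k : nat) : (0 < k)%N -> 0 < Num.sqrt (k%:R : R).
  by move=> k0; rewrite sqrtr_gt0 ltr0n.
have step q : (0 < q < N)%N -> (S (i + N)%N - S i) / N%:R <=
    (S (i + q)%N - S i) / q%:R + tau * (Num.sqrt N%:R / q%:R).
  move=> /andP[q0 qN]; rewrite (mean_increment S i q0); last by lia.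
  rewrite lerD2l mulrA ler_pM2r ?invr_gt0 ?ltr0n//.
  have := H (i + q)%N (i + N)%N; rewrite addKn; apply; lia.
have pR : 0 < (p%:R : R) by rewrite ltr0n.
have NR : 0 < (N%:R : R) by rewrite ltr0n; lia.
have [eNp|nNp] := eqVneq N p.
  rewrite eNp lerDl mulr_ge0// -mulrBl divr_ge0 ?sqrtr_ge0//; lra.
have [N2p|N2p] := leqP N (2 * p).
  apply: (le_trans (step p _)); first by lia.
  rewrite lerD2l ler_wpM2l//.
  have a0 := sqp p p0; have b0 : 0 < Num.sqrt (N%:R : R) by apply: sqp; lia.
  set a := Num.sqrt (p%:R : R) in a0 *; set b := Num.sqrt (N%:R : R) in b0 *.
  have ea : p%:R = a ^+ 2 :> R by rewrite sqr_sqrtr// ler0n.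
  have eb : N%:R = b ^+ 2 :> R by rewrite sqr_sqrtr// ler0n.
  have hab : a <= b by rewrite ler_sqrt ?ler_nat//; lia.
  have hb2 : b ^+ 2 <= 2 * a ^+ 2 by rewrite -ea -eb -natrM ler_nat.
  rewrite ea; have -> : b / a ^+ 2 = (b / a) / a by rewrite expr2 invfM mulrA.
  have : b / a <= 2 by rewrite ler_pdivrMr//; nra.
  move=> hba; have : b / a / a <= 2 / a by rewrite ler_pM2r ?invr_gt0.
  have : 10 / b <= 10 / a by rewrite ler_pM2l ?lef_pV2 ?posrE//; lra.
  lra.
(* q is half of N rounded up: q <= 2 N / 3 makes 1 / sqrt q exceed
   1 / sqrt N by a fixed factor, which pays for the change of the mean *)
pose q := (N.+1)./2.
have hq : [/\ (p <= q)%N, (q < N)%N, (N <= 2 * q)%N & (3 * q <= 2 * N)%N].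
  by rewrite /q; split; lia.
case: hq => pq qN N2q q3.
apply: (le_trans (step q _)); first by lia.
have := IH q pq; rewrite -ltnS => /(_ (leq_trans qN MN)) IHq.
have {}IHq := IHq (fun k j h1 h2 => H k j h1 (leq_trans h2 (leq_add (leqnn i) (ltnW qN)))).
apply: (le_trans (lerD IHq (lexx _))); rewrite -addrA lerD2l -mulrDr ler_wpM2l//.
have a0 := sqp q (leq_trans p0 pq); have b0 : 0 < Num.sqrt (N%:R : R) by apply: sqp; lia.
set a := Num.sqrt (q%:R : R) in a0 *; set b := Num.sqrt (N%:R : R) in b0 *.
have ea : q%:R = a ^+ 2 :> R by rewrite sqr_sqrtr// ler0n.
have eb : N%:R = b ^+ 2 :> R by rewrite sqr_sqrtr// ler0n.
have h1 : b ^+ 2 <= 2 * a ^+ 2 by rewrite -ea -eb -natrM ler_nat.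
have h2 : 3 * a ^+ 2 <= 2 * b ^+ 2 by rewrite -ea -eb -!natrM ler_nat.
suff : b / q%:R + 10 / b <= 10 / a by lra.
rewrite ea; have -> : b / a ^+ 2 + 10 / b = ((b ^+ 2 + 10 * a ^+ 2) / (a * b)) / a.
  have ha : a / a = 1 by rewrite divff// gt_eqF.
  have hb : b / b = 1 by rewrite divff// gt_eqF.
  rewrite !expr2 !invfM.
  have e1 : b / b * (b / a / a) = b / a / a by rewrite hb mul1r.
  have e2 : a / a * (a / a) * (10 / b) = 10 / b by rewrite ha !mul1r.
  lra.
rewrite ler_pM2r ?invr_gt0// ler_pdivrMr ?mulr_gt0//.
(* with x = a^2 / b^2 in [1/2, 2/3] one has 1 + 10 x <= 10 sqrt x *)
have h3 : 6 * a <= 5 * b by nra.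
have h4 : 7 * b <= 10 * a by nra.
nra.
Qed.

(** Reading S backwards exchanges the two ends of a chord: estimates for
    windows with a fixed left end then hold for a fixed right end. *)
Lemma chord_gap_rev (R : realType) (S : nat -> R) (M i k j : nat) :
  (i < k < j)%N -> (j <= M)%N ->
  chord_gap (fun l => S (M - l)%N) i k j = chord_gap S (M - j) (M - k) (M - i).
Proof.
move=> /andP[ik kj] jM; rewrite /chord_gap !natrB; [|lia..].
have -> : M%:R - i%:R - (M%:R - j%:R) = j%:R - i%:R :> R by lra.
congr (_ / _ - _); lra.
Qed.

(** Both the first and the last window of p cells are compared with the whole
    window of N cells, so the distance between the two short windows does not
    enter the bound. *)
Lemma means_of_small_chord_gaps (R : realType) (S : nat -> R) (tau : R)
    (i p N : nat) :
  0 <= tau -> (0 < p <= N)%N ->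
  (forall i' k j, (i <= i')%N -> (i' < k < j)%N -> (j <= i + N)%N ->
     chord_gap S i' k j <= tau * Num.sqrt (j - i')%:R) ->
  (S (i + N)%N - S (i + N - p)%N) / p%:R - (S (i + p)%N - S i) / p%:R <=
  24 * tau / Num.sqrt p%:R.
Proof.
move=> tau0 pN H.
have L := mean_chaining tau0 pN (fun k j => H i k j (leqnn i)).
have/andP[p0 pN'] := pN.
have := @mean_chaining R (fun l => S (i + N - l)%N) tau 0 p N tau0 pN.
have H' k j : (0 < k < j)%N -> (j <= 0 + N)%N ->
    chord_gap (fun l => S (i + N - l)%N) 0 k j <= tau * Num.sqrt (j - 0)%:R.
  move=> kj jN; rewrite chord_gap_rev//; last by lia.
  have := H (i + N - j)%N (i + N - k)%N (i + N - 0)%N.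
  have -> : (i + N - 0 - (i + N - j) = j - 0)%N by lia.
  apply; lia.
move=> /(_ H'); rewrite !add0n subn0 addnK => Rr.
have N0 : 0 <= tau * (10 / Num.sqrt (N%:R : R)).
  by rewrite mulr_ge0// divr_ge0// sqrtr_ge0.
move: L Rr N0; rewrite !mulrBr !mulrBl; lra.
Qed.

Lemma sum_nat_le_const (R : realType) (z : nat -> R) (a p : nat) (A : R) :
  (forall l, (a < l <= a + p)%N -> z l <= A) ->
  partial_sum z (a + p) - partial_sum z a <= p%:R * A.
Proof.
move=> H; rewrite /partial_sum (@big_cat_nat _ _ _ a.+1) //=; last by rewrite ltnS leq_addr.
rewrite addrAC subrr add0r.
apply: (le_trans (y := \sum_(a.+1 <= i < (a + p).+1) A)).
  by apply: ler_sum_nat => l /andP[h1 h2]; apply: H; rewrite h1.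
by rewrite sumr_const_nat subSS addKn mulr_natl.
Qed.

(** If chord gaps are at most tau times the square root of the length, the
    data cannot stay below A on p cells and above B on p later cells, however
    far apart, unless (B - A) sqrt p is of order tau. *)
Lemma level_rise_of_small_chord_gaps (R : realType) (z : nat -> R) (tau A B : R)
    (i p N : nat) :
  0 <= tau -> (0 < p <= N)%N ->
  (forall l, (i < l <= i + p)%N -> z l <= A) ->
  (forall l, (i + N - p < l <= i + N)%N -> B <= z l) ->
  (forall i' k j, (i <= i')%N -> (i' < k < j)%N -> (j <= i + N)%N ->
     chord_gap (partial_sum z) i' k j <= tau * Num.sqrt (j - i')%:R) ->
  (B - A) * Num.sqrt p%:R <= 24 * tau.
Proof.
move=> tau0 pN zA zB H; have := means_of_small_chord_gaps tau0 pN H.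
have /andP[p0 pN'] := pN.
have p0R : 0 < p%:R :> R by rewrite ltr0n.
rewrite /partial_sum; have := sum_nat_le_const zA; rewrite /partial_sum => h1.
have := @sum_nat_le_const R (fun l => - z l) (i + N - p) p (- B).
rewrite /partial_sum !sumrN subnK; last by lia.
move=> /(_ _)h2.
have {}h2 := h2 (fun l hl => ltac:(rewrite lerN2; exact: zB)).
have sp0 : 0 < Num.sqrt (p%:R : R) by rewrite sqrtr_gt0.
rewrite -mulrBl !ler_pdivlMr// => h3; apply: le_trans h3.
rewrite ler_pM2r// ler_pdivlMr//.
nra.
Qed.

(** * Least concave majorants of cumulative sum diagrams *)

Lemma partial_sumS (R : realType) (z : nat -> R) k :
  partial_sum z k.+1 = partial_sum z k + z k.+1.
Proof. by rewrite /partial_sum big_nat_recr. Qed.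

Lemma cusum_grid (R : realType) m (z : nat -> R) k : (0 < m)%N ->
  cusum m z (k%:R / m%:R) = partial_sum z k / m%:R.
Proof.
move=> m0; have e : m%:R * (k%:R / m%:R) = k%:R :> R.
  by rewrite mulrC divfK// pnatr_eq0 -lt0n.
rewrite /cusum; cbv zeta; rewrite e.
rewrite (@truncn_def _ _ k); last by rewrite lexx ltr_nat /=.
by rewrite subrr mul0r addr0 mulrC.
Qed.

(** The diagram is affine between grid points, so bounds at the grid points of
    an interval hold on the whole interval. *)
Lemma cusum_between (R : realType) m (z : nat -> R) (i j : nat) (t lo hi : R) :
  (0 < m)%N -> i%:R / m%:R <= t <= j%:R / m%:R ->
  (forall k, (i <= k <= j)%N -> lo <= partial_sum z k <= hi) ->
  lo / m%:R <= cusum m z t <= hi / m%:R.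
Proof.
move=> m0 tij H; have mR : 0 < (m%:R : R) by rewrite ltr0n.
move: tij; rewrite ler_pdivrMr// ler_pdivlMr// mulrC => /andP[it tj].
have x0 : 0 <= m%:R * t by rewrite (le_trans _ it).
have /andP[k1 k2] := truncn_itv x0.
rewrite /cusum; cbv zeta; rewrite -[\sum_(_ <= _ < _) _]/(partial_sum z _).
set k := Num.truncn _ in k1 k2 *; set th := m%:R * t - k%:R.
have ik : (i <= k)%N by rewrite -ltnS -(@ltr_nat R) (le_lt_trans it).
have kj : (k <= j)%N by rewrite -(@ler_nat R) (le_trans k1).
rewrite [m%:R^-1 * _]mulrC !ler_pM2r ?invr_gt0//.
have /andP[a1 a2] := H k (introT andP (conj ik kj)).
have th0 : 0 <= th by rewrite subr_ge0.
have th1 : th <= 1 by rewrite /th; move: k2; rewrite -natr1; lra.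
have [kltj|jk] := ltnP k j.
  have /andP[] := H k.+1 (introT andP (conj (leqW ik) kltj)).
  rewrite partial_sumS => b1 b2; apply/andP; split; nra.
have -> : th = 0.
  apply/eqP; rewrite eq_le th0 andbT subr_le0 (le_trans tj)// ler_nat//.
by rewrite mul0r addr0 a1.
Qed.

Lemma cusumB (R : realType) m (z z' : nat -> R) t :
  cusum m z t - cusum m z' t = cusum m (fun i => z i - z' i) t.
Proof.
by rewrite /cusum; cbv zeta; rewrite sumrB -mulrBr opprD addrACA -mulrBr. Qed.

Lemma concave_onP (R : realType) (a b : R) (h : R -> R) :
  concave_on a b h <->
  (forall t x y : R, 0 <= t <= 1 -> a <= x <= b -> a <= y <= b ->
     t * h x + (1 - t) * h y <= h (t * x + (1 - t) * y)).
Proof.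
split=> [H t x y t01 xab yab|H t x y].
  have tP : Itv.spec (Itv.num_sem (R:=R)) (Itv.Real `[0%Z, 1%Z]) t.
    by rewrite /= /Itv.num_sem num_real /= in_itv.
  have := H (Itv.mk tP) x y; rewrite !inE /= !in_itv => /(_ xab yab) H1.
  have {H1} : - h (t * x + (1 - t) * y) <= t * - h x + (1 - t) * - h y := H1.
  by rewrite !mulrN -opprD lerN2.
rewrite !inE /= !in_itv => xab yab.
have t01 : 0 <= t%:num <= 1 by apply/andP; split.
have := H t%:num x y t01 xab yab.
by rewrite -lerN2 opprD -!mulrN.
Qed.

Lemma concave_on_cst (R : realType) (a b c : R) : concave_on a b (fun=> c).
Proof. by apply/concave_onP => t x y _ _ _; lra. Qed.

Lemma concave_on_addr (R : realType) (a b c : R) h :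
  concave_on a b h -> concave_on a b (fun x => h x + c).
Proof.
move=> /concave_onP hh; apply/concave_onP => t x y t01 xab yab.
have := hh t x y t01 xab yab; lra.
Qed.

Lemma concave_on_chord (R : realType) (a b u v w : R) h : concave_on a b h ->
  a <= u -> u < v -> v <= b -> u <= w <= v ->
  ((v - w) * h u + (w - u) * h v) / (v - u) <= h w.
Proof.
move=> /concave_onP hh au uv vb /andP[uw wv].
have vu0 : 0 < v - u by rewrite subr_gt0.
have vun0 : v - u != 0 by rewrite gt_eqF.
pose t := (v - w) / (v - u).
have e : t * (v - u) = v - w by rewrite divfK.
have t01 : 0 <= t <= 1.
  by rewrite divr_ge0 ?ler_pdivrMr//; lra.
have := hh t u v t01; rewrite au vb (le_trans (ltW uv) vb) (le_trans au (ltW uv)).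
move=> /(_ isT isT).
have -> : t * u + (1 - t) * v = w by lra.
apply: le_trans; rewrite ler_pdivrMr//.
have -> : (t * h u + (1 - t) * h v) * (v - u) =
  (t * (v - u)) * h u + (v - u - t * (v - u)) * h v by lra.
rewrite e; lra.
Qed.

Section majorant.
Variables (R : realType) (a b : R) (G : R -> R) (lo hi : R).
Hypothesis Glohi : forall t, t \in `[a, b] -> lo <= G t <= hi.

Lemma least_concave_majorant_le h t : t \in `[a, b] -> concave_on a b h ->
  (forall u, u \in `[a, b] -> G u <= h u) -> least_concave_majorant a b G t <= h t.
Proof.
move=> tab hc Gh; apply: ge_inf; last by exists h.
by exists (G t) => _ [g [_ Gg] <-]; apply: Gg.
Qed.

Lemma le_least_concave_majorant t x : (forall h, concave_on a b h ->
    (forall u, u \in `[a, b] -> G u <= h u) -> x <= h t) ->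
  x <= least_concave_majorant a b G t.
Proof.
move=> H; apply: lb_le_inf; last by move=> _ [h [hc Gh] <-]; apply: H.
exists hi, (fun=> hi) => //; split; first exact: concave_on_cst.
by move=> u /Glohi /andP[].
Qed.

Lemma gap_le t : t \in `[a, b] -> least_concave_majorant a b G t - G t <= hi - lo.
Proof.
move=> tab; have /andP[lt _] := Glohi tab.
rewrite lerB//; apply: (least_concave_majorant_le (h := fun=> hi)) => //; first exact: concave_on_cst.
by move=> u /Glohi /andP[].
Qed.

Lemma sup_gap_ge t : t \in `[a, b] ->
  least_concave_majorant a b G t - G t <= sup_gap a b G.
Proof.
move=> tab; apply: ub_le_sup; last by exists t.
by exists (hi - lo) => _ [u uab <-]; apply: gap_le.
Qed.

Lemma sup_gap_le : a <= b -> sup_gap a b G <= hi - lo.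
Proof.
move=> ab; apply: ge_sup; last by move=> _ [u uab <-]; apply: gap_le.
by exists (least_concave_majorant a b G a - G a), a; rewrite //= in_itv/= lexx.
Qed.

Lemma chord_le_sup_gap u v w : a <= u -> u < v -> v <= b -> u <= w <= v ->
  ((v - w) * G u + (w - u) * G v) / (v - u) - G w <= sup_gap a b G.
Proof.
move=> au uv vb /andP[uw wv].
apply: le_trans (sup_gap_ge (t := w) _); last by rewrite in_itv/=; apply/andP; split; lra.
rewrite lerD2r; apply: le_least_concave_majorant => h hc Gh.
have hu : G u <= h u by apply: Gh; rewrite in_itv/=; apply/andP; split; lra.
have hv : G v <= h v by apply: Gh; rewrite in_itv/=; apply/andP; split; lra.
have vu : 0 < v - u by lra.
apply: le_trans (concave_on_chord hc au uv vb _); last by rewrite uw.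
rewrite ler_pM2r ?invr_gt0//; apply: lerD; apply: ler_wpM2l => //; lra.
Qed.

End majorant.

(** Adding d to a concave majorant of G' gives a concave majorant of G, so the
    least concave majorant moves by at most the uniform distance. *)
Lemma sup_gap_close (R : realType) (a b lo hi d : R) (G G' : R -> R) : a <= b ->
  (forall t, t \in `[a, b] -> lo <= G t <= hi) ->
  (forall t, t \in `[a, b] -> lo <= G' t <= hi) ->
  (forall t, t \in `[a, b] -> `|G t - G' t| <= d) ->
  sup_gap a b G <= sup_gap a b G' + 2 * d.
Proof.
move=> ab Gb G'b GG'; apply: ge_sup.
  by exists (least_concave_majorant a b G a - G a), a; rewrite //= in_itv/= lexx.
move=> _ [t tab <-].
have := sup_gap_ge G'b tab; have := GG' _ tab; rewrite ler_norml => /andP[h1 h2].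
suff : least_concave_majorant a b G t - d <= least_concave_majorant a b G' t by lra.
apply: (le_least_concave_majorant G'b) => h hc Gh; rewrite lerBlDr.
apply: (least_concave_majorant_le (h := fun x => h x + d)) => //; first exact: concave_on_addr.
move=> u uab; have := Gh _ uab; have := GG' _ uab; rewrite ler_norml => /andP[].
lra.
Qed.

Lemma chord_gap_le_sup_gap (R : realType) m (z : nat -> R) (i k j : nat) :
  (0 < m)%N -> (i < k < j)%N ->
  chord_gap (partial_sum z) i k j / m%:R <=
  sup_gap (i%:R / m%:R) (j%:R / m%:R) (cusum m z).
Proof.
move=> m0 /andP[ik kj].
have mR : 0 < (m%:R : R) by rewrite ltr0n.
have le_div (a b : nat) : (a <= b)%N -> a%:R / m%:R <= b%:R / m%:R :> R.
  by move=> ab; rewrite ler_pM2r ?invr_gt0// ler_nat.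
have lt_div (a b : nat) : (a < b)%N -> a%:R / m%:R < b%:R / m%:R :> R.
  by move=> ab; rewrite ltr_pM2r ?invr_gt0// ltr_nat.
pose B := \sum_(1 <= l < j.+1) `|z l|.
have bd t : t \in `[(i%:R / m%:R), (j%:R / m%:R)] ->
    - B / m%:R <= cusum m z t <= B / m%:R.
  rewrite in_itv/= => tij; apply: cusum_between tij _ => // l /andP[_ lj].
  rewrite -ler_norml; apply: (le_trans (ler_norm_sum _ _ _)).
  rewrite /B (@big_cat_nat _ _ _ l.+1 1 j.+1) //= lerDl.
  by rewrite sumr_ge0.
have := @chord_le_sup_gap R _ _ _ _ _ bd (i%:R / m%:R) (j%:R / m%:R) (k%:R / m%:R).
move=> /(_ (lexx _) (lt_div _ _ (ltn_trans ik kj)) (lexx _)).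
rewrite !le_div 1?ltnW// => /(_ isT).
rewrite !cusum_grid//; apply: le_trans; rewrite /chord_gap -!mulrBl.
rewrite invfM invrK; set u := m%:R^-1; set v := (j%:R - i%:R)^-1.
have um : u * m%:R = 1 by rewrite mulVf// gt_eqF.
set A := partial_sum z i; set B' := partial_sum z j.
have e : u * m%:R * (((j%:R - k%:R) * A + (k%:R - i%:R) * B') * v * u) =
   ((j%:R - k%:R) * A + (k%:R - i%:R) * B') * v * u by rewrite um mul1r.
lra.
Qed.

(** A constant is concave, so the least concave majorant lies below the
    maximum of the diagram on the interval. *)
Lemma sup_gap_cusum_le (R : realType) m (z : nat -> R) (i j : nat) (B : R) :
  (0 < m)%N -> (i <= j)%N ->
  (forall k, (i < k <= j)%N -> `|partial_sum z k - partial_sum z i| <= B) ->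
  sup_gap (i%:R / m%:R) (j%:R / m%:R) (cusum m z) <= 2 * `|B| / m%:R.
Proof.
move=> m0 ij H; have mR : 0 < (m%:R : R) by rewrite ltr0n.
pose c := partial_sum z i.
have -> : 2 * `|B| / m%:R = (c + `|B|) / m%:R - (c - `|B|) / m%:R.
  by rewrite -mulrBl; congr (_ / _); lra.
apply: sup_gap_le; last by rewrite ler_pM2r ?invr_gt0// ler_nat.
move=> t; rewrite in_itv/= => tij; apply: cusum_between tij _ => // k /andP[ik kj].
have [->|ki] := eqVneq k i; first by rewrite -/c; have := normr_ge0 B; lra.
have := H k; rewrite kj ltn_neqAle eq_sym ki ik => /(_ isT).
rewrite -/c ler_norml => /andP[h1 h2]; have := ler_norm B; lra.
Qed.

Lemma sup_gap_cusum_lip (R : realType) m (z z' : nat -> R) (i j : nat) :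
  (0 < m)%N -> (i <= j <= m)%N ->
  sup_gap (i%:R / m%:R) (j%:R / m%:R) (cusum m z) <=
  sup_gap (i%:R / m%:R) (j%:R / m%:R) (cusum m z') +
  2 * (\sum_(1 <= l < m.+1) `|z l - z' l|).
Proof.
move=> m0 /andP[ij jm]; have mR : 0 < (m%:R : R) by rewrite ltr0n.
have m1 : 1 <= (m%:R : R) by rewrite ler1n.
have bd (y : nat -> R) t : t \in `[(i%:R / m%:R), (j%:R / m%:R)] ->
    `|cusum m y t| <= \sum_(1 <= l < m.+1) `|y l|.
  rewrite in_itv/= => tij; set B := \sum_(_ <= _ < _) _.
  have B0 : 0 <= B by rewrite sumr_ge0.
  have : `|cusum m y t| <= B / m%:R.
    rewrite ler_norml -mulNr; apply: cusum_between tij _ => // l /andP[_ lj].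
    rewrite -ler_norml; apply: (le_trans (ler_norm_sum _ _ _)).
    rewrite /B (@big_cat_nat _ _ _ l.+1 1 m.+1) //=; last by lia.
    by rewrite lerDl sumr_ge0.
  by move/le_trans; apply; rewrite ler_pdivrMr// ler_peMr.
pose B := \sum_(1 <= l < m.+1) `|z l|; pose B' := \sum_(1 <= l < m.+1) `|z' l|.
have B0 : 0 <= B by rewrite sumr_ge0.
have B0' : 0 <= B' by rewrite sumr_ge0.
apply: (@sup_gap_close _ _ _ (- (B + B')) (B + B')).
- by rewrite ler_pM2r ?invr_gt0// ler_nat.
- by move=> t /(bd z); rewrite -/B ler_norml => /andP[]; lra.
- by move=> t /(bd z'); rewrite -/B' ler_norml => /andP[]; lra.
- by move=> t tI; rewrite cusumB; exact: bd.
Qed.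

(** * Measurability of functionals of finitely many variables *)

Lemma measurable_lt_set d (T : measurableType d) (R : realType) (f g : T -> R) :
  measurable_fun setT f -> measurable_fun setT g ->
  measurable [set w | f w < g w].
Proof.
move=> mf mg; have := measurable_fun_ltr mf mg measurableT (Y := [set true]).
by rewrite setTI preimage_true; apply.
Qed.

Lemma measurable_le_set d (T : measurableType d) (R : realType) (f g : T -> R) :
  measurable_fun setT f -> measurable_fun setT g ->
  measurable [set w | f w <= g w].
Proof.
move=> mf mg; have := measurable_fun_ler mf mg measurableT (Y := [set true]).
by rewrite setTI preimage_true; apply.
Qed.

Lemma measurable_eq_set d (T : measurableType d) (R : realType) (f : T -> R) c :
  measurable_fun setT f -> measurable [set w | f w = c].
Proof.
move=> mf; have -> : [set w | f w = c] = [set w | f w <= c] `&` [set w | c <= f w].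
  apply/seteqP; split => w /=; first by move=> ->.
  by move=> [h1 h2]; apply/eqP; rewrite eq_le h1.
by apply: measurableI; apply: measurable_le_set.
Qed.

Lemma measurable_fun_ltP d (T : measurableType d) (R : realType) (f : T -> R) :
  (forall x, measurable [set w | f w < x]) -> measurable_fun setT f.
Proof.
move=> H; apply: (measurability (@RGenInftyO.G R)) => [|/= _ [_] [r] -> <-].
  exact: RGenInftyO.measurableE.
by rewrite setTI (_ : _ @^-1` _ = [set w | f w < r]).
Qed.

(** A function Lipschitz in finitely many coordinates is the infimum, over
    rational points q, of the measurable functions
    F q + C * sum of |Z l - q l|; this avoids any formula for the least concave
    majorant when proving that the statistics are measurable. *)
Lemma measurable_lipschitz d (T : measurableType d) (R : realType) (m : nat)
    (F : (nat -> R) -> R) (C : R) (Z : nat -> T -> R) :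
  0 <= C ->
  (forall z z', F z <= F z' + C * \sum_(1 <= l < m.+1) `|z l - z' l|) ->
  (forall i, measurable_fun setT (Z i)) ->
  measurable_fun setT (fun w => F (Z ^~ w)).
Proof.
move=> C0 HF mZ; apply: measurable_fun_ltP => x.
pose q (k l : nat) : R := ratr (nth 0 (odflt [::] (unpickle k) : seq rat) l).
have -> : [set w | F (Z ^~ w) < x] = \bigcup_k
    [set w | F (q k) + C * \sum_(1 <= l < m.+1) `|Z l w - q k l| < x].
  apply/seteqP; split => [w /= Fx|w [k _ /=]]; last exact: le_lt_trans.
  pose D := x - F (Z ^~ w).
  have D0 : 0 < D by rewrite subr_gt0.
  pose e := D / (4 * (C + 1) * (m%:R + 1)).
  have den0 : 0 < 4 * (C + 1) * (m%:R + 1).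
    by have := ler0n R m; rewrite !mulr_gt0//; lra.
  have e0 : 0 < e by rewrite divr_gt0.
  have /choice [r rP] l : exists r : rat, `|Z l w - ratr r| < e.
    have /(@rat_in_itvoo R) [r] : Z l w - e < Z l w + e by lra.
    by rewrite in_itv/= => /andP[h1 h2]; exists r; rewrite ltr_norml; apply/andP; split; lra.
  exists (pickle (mkseq r m.+1)) => //=.
  have qE l : (l < m.+1)%N -> q (pickle (mkseq r m.+1)) l = ratr (r l).
    by move=> lm; rewrite /q pickleK /= nth_mkseq.
  set k := pickle _ in qE *.
  have S1 : \sum_(1 <= l < m.+1) `|Z l w - q k l| <= e * m%:R.
    apply: (@le_trans _ _ (\sum_(1 <= l < m.+1) e)).
      by apply: ler_sum_nat => l /andP[_ lm]; rewrite qE// ltW.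
    by rewrite sumr_const_nat subn1 mulr_natr.
  have S2 : \sum_(1 <= l < m.+1) `|q k l - Z l w| <= e * m%:R.
    by under eq_bigr do rewrite distrC.
  have := HF (q k) (Z ^~ w).
  have /= := ler_wpM2l C0 S1; have /= := ler_wpM2l C0 S2.
  have em : e * (4 * (C + 1) * (m%:R + 1)) = D by rewrite divfK// gt_eqF.
  have Cem0 : 0 <= C * e by rewrite mulr_ge0// ltW.
  have em0 : 0 <= e * m%:R by rewrite mulr_ge0// ltW.
  move: em; rewrite /D; lra.
apply: bigcupT_measurable => k.
apply: measurable_lt_set => //; apply: measurable_funD => //.
apply: measurable_funM => //; apply: measurable_sum => l.
by apply: measurableT_comp => //; exact: measurable_funB.
Qed.

(** The inverse is a power function on each half-line, with value 0 at 0. *)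
Lemma measurable_inv (R : realType) : measurable_fun setT (fun x : R => x^-1).
Proof.
have -> : (fun x : R => x^-1) =
    (fun x => if 0 <= x then x `^ (-1) else - ((- x) `^ (-1))).
  apply/funext => x; case: ifPn => [x0|]; first by rewrite powR_inv1.
  by rewrite -ltNge => x0; rewrite powR_inv1 ?oppr_ge0 ?ltW// invrN opprK.
apply: measurable_fun_ifT => //.
  exact: measurable_fun_ler.
apply: measurableT_comp => //.
exact: (measurableT_comp (@measurable_powR R (-1)) (@oppr_measurable R _)).
Qed.

Lemma measurable_sqrt (R : realType) : measurable_fun setT (@Num.sqrt R).
Proof. by apply: nondecreasing_measurable => // x y; exact: ler_wsqrtr. Qed.

Lemma measurable_max_grid d (T : measurableType d) (R : realType) (m : nat)
    (S : T -> R -> R -> R) :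
  (forall i j, (i < j <= m)%N ->
     measurable_fun setT (fun w => S w (i%:R / m%:R) (j%:R / m%:R))) ->
  measurable_fun setT (fun w => max_grid m (S w)).
Proof.
move=> mS; rewrite /max_grid.
elim: index_enum => [|ij r IH].
  by under eq_fun do rewrite big_nil; exact: measurable_cst.
have [ijlt|ijlt] := boolP (ij.1 < ij.2)%N; last first.
  by under eq_fun do rewrite big_cons (negbTE ijlt).
under eq_fun do rewrite big_cons ijlt.
apply: measurable_maxr => //; apply: mS.
by rewrite ijlt /= -ltnS.
Qed.

Lemma measurable_sup_gap d (T : measurableType d) (R : realType) (m i j : nat)
    (Z : nat -> T -> R) : (i < j <= m)%N -> (forall l, measurable_fun setT (Z l)) ->
  measurable_fun setT
    (fun w => sup_gap (i%:R / m%:R) (j%:R / m%:R) (cusum m (Z ^~ w))).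
Proof.
move=> /andP[ij jm] mZ.
apply: (@measurable_lipschitz _ _ _ m
  (fun z => sup_gap (i%:R / m%:R) (j%:R / m%:R) (cusum m z)) 2) => // z z'.
by apply: sup_gap_cusum_lip; [lia|rewrite ltnW].
Qed.

(** * Expectations of products of independent variables *)

Section change_of_measure.
Local Open Scope ereal_scope.
Context d1 d2 (T1 : measurableType d1) (T2 : measurableType d2) (R : realType).
Variables (mu : {measure set T1 -> \bar R}) (nu : {measure set T2 -> \bar R}).
Variables (Y : T1 -> T2) (H : T1 -> R).
Hypotheses (mY : measurable_fun setT Y) (mH : measurable_fun setT H).
Hypothesis H0 : forall w, (0 <= H w)%R.
Hypothesis HY : forall B : set T2, measurable B ->
  \int[mu]_w (H w * \1_B (Y w))%:E = nu B.

Import HBNNSimple.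

(** The hypothesis says that nu is the image by Y of the measure of density H;
    both sides are then limits of integrals of the same simple functions of Y.
    Used with H a product of other independent factors, and with H a
    probability density. *)
Lemma integral_density (g : T2 -> R) :
  measurable_fun setT g -> (forall y, 0 <= g y)%R ->
  \int[mu]_w (H w * g (Y w))%:E = \int[nu]_y (g y)%:E.
Proof.
move=> mg g0; have mgE : measurable_fun setT (EFin \o g) by exact/measurable_EFinP.
pose g_ := nnsfun_approx measurableT mgE.
have g_cvg y : (g_ n y)%:E @[n --> \oo] --> (g y)%:E.
  by apply: cvg_nnsfun_approx => // x _; rewrite /= lee_fin.
have g_nd y m n : (m <= n)%N -> (g_ m y <= g_ n y)%R.
  by move=> mn; exact/lefP/nd_nnsfun_approx.
have mind (B : set T2) : measurable B -> measurable_fun setT (fun w => \1_B (Y w) : R).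
  by move=> mB; apply: measurableT_comp => //; exact: measurable_indic.
have simple n : \int[mu]_w (H w * g_ n (Y w))%:E = \int[nu]_y (g_ n y)%:E.
  transitivity (\int[nu]_y \sum_(r \in range (g_ n))
      (r * \1_(g_ n @^-1` [set r]) y)%:E); last first.
    by apply: eq_integral => t _; rewrite fsumEFin// -fimfunE.
  rewrite ge0_integral_fsum//; last 2 first.
  - by move=> r; exact/measurable_EFinP/measurable_funM.
  - by move=> r x _; rewrite nnfun_muleindic_ge0.
  transitivity (\int[mu]_w \sum_(r \in range (g_ n))
      (r * (H w * \1_(g_ n @^-1` [set r]) (Y w)))%:E).
    apply: eq_integral => t _; rewrite fsumEFin//; congr EFin.
    by rewrite fimfunE mulr_fsumr//; apply: eq_fsbigr => r _; rewrite mulrCA.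
  have mterm r : measurable_fun setT (fun w => H w * \1_(g_ n @^-1` [set r]) (Y w))%R.
    by apply: measurable_funM => //; exact: mind.
  have r0 r w : (0 <= (r * \1_(g_ n @^-1` [set r]) (Y w)))%R.
    by have := nnfun_muleindic_ge0 (g_ n) r (Y w); rewrite lee_fin.
  rewrite ge0_integral_fsum//; last 2 first.
  - by move=> r; apply/measurable_EFinP/measurable_funM.
  - by move=> r x _; rewrite lee_fin mulrCA mulr_ge0.
  apply: eq_fsbigr => r; rewrite inE => -[y _ yr].
  have rge0 : (0 <= r)%R by rewrite -yr.
  rewrite [LHS](_ : _ = \int[mu]_w (r%:E * (H w * \1_(g_ n @^-1` [set r]) (Y w))%:E))//.
  rewrite ge0_integralZl_EFin//; last 2 first.
  - by move=> w _; rewrite lee_fin mulr_ge0.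
  - exact/measurable_EFinP.
  by rewrite HY// integralZl_indic_nnsfun// integral_indic// setIT.
have L : (fun n => \int[mu]_w (H w * g_ n (Y w))%:E) @ \oo -->
    \int[mu]_w (H w * g (Y w))%:E.
  have -> : \int[mu]_w (H w * g (Y w))%:E =
      \int[mu]_w limn (fun n => (H w * g_ n (Y w))%:E).
    apply: eq_integral => w _; apply/esym/cvg_lim => //.
    under eq_fun do rewrite EFinM; rewrite EFinM.
    by apply: cvgeZl => //; exact: g_cvg.
  apply: cvg_monotone_convergence => //.
  - move=> n; apply/measurable_EFinP/measurable_funM => //.
    by apply: measurableT_comp.
  - by move=> n w _; rewrite lee_fin mulr_ge0.
  - by move=> w _ a b ab; rewrite lee_fin ler_wpM2l// g_nd.
have Rr : (fun n => \int[nu]_y (g_ n y)%:E) @ \oo --> \int[nu]_y (g y)%:E.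
  have -> : \int[nu]_y (g y)%:E = \int[nu]_y limn (fun n => (g_ n y)%:E).
    by apply: eq_integral => w _; apply/esym/cvg_lim => //; exact: g_cvg.
  apply: cvg_monotone_convergence => //.
  - by move=> n; exact/measurable_EFinP.
  - by move=> n w _; rewrite lee_fin.
  - by move=> w _ a b ab; rewrite lee_fin g_nd.
have e : (fun n => \int[mu]_w (H w * g_ n (Y w))%:E) =
    (fun n => \int[nu]_y (g_ n y)%:E) by apply/funext => n; exact: simple.
rewrite e in L.
exact: (cvg_unique (@ereal_hausdorff R) L Rr).
Qed.

End change_of_measure.

Section independence.
Context d (T : measurableType d) (R : realType) (P : probability T R).

Lemma prod_indic (I : eqType) (r : seq I) (B : I -> set T) w :
  \prod_(i <- r) (\1_(B i) w : R) = \1_(\bigcap_(i in [set` r]) B i) w.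
Proof.
have [h|] := pselect (forall i, i \in r -> B i w).
  rewrite big1_seq => [|i /andP[_ /h Biw]]; last by rewrite indicE mem_set.
  by rewrite indicE mem_set// => i /= /h.
move=> h; rewrite [RHS]indicE memNset; last first.
  by move=> H; apply: h => i ir; apply: H.
have /existsNP[i /not_implyP[ir Bi]] := h.
by rewrite (big_rem i ir) /= indicE memNset// mul0r.
Qed.

(** Independence is the case where all factors are indicators. General
    factors are introduced one at a time: with the other factors fixed, both
    sides are measures in the set whose indicator is replaced. *)
Lemma expectation_prod_independent (n : nat) (X : nat -> {RV P >-> R})
    (g : nat -> R -> R) (e : nat -> R) :
  mutually_independent P n X ->
  (forall i, measurable_fun setT (g i)) -> (forall i x, 0 <= g i x) ->
  (forall i, (\int[P]_w (g i (X i w))%:E = (e i)%:E)%E) ->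
  (\int[P]_w (\prod_(1 <= i < n.+1) g i (X i w))%:E =
   (\prod_(1 <= i < n.+1) e i)%:E)%E.
Proof.
move=> indep.
suff H k : (k <= n)%N -> forall (g : nat -> R -> R) (e : nat -> R),
    (forall i, (i <= k)%N \/ exists2 B, measurable B & g i = \1_B) ->
    (forall i, measurable_fun setT (g i)) -> (forall i x, 0 <= g i x) ->
    (forall i, (\int[P]_w (g i (X i w))%:E = (e i)%:E)%E) ->
    (\int[P]_w (\prod_(1 <= i < n.+1) g i (X i w))%:E =
     (\prod_(1 <= i < n.+1) e i)%:E)%E.
  (* beyond n the factors are replaced by 1, an indicator *)
  move=> mg g0 ge; pose g' i := if (i <= n)%N then g i else \1_setT.
  pose e' i := if (i <= n)%N then e i else 1.
  have -> : \prod_(1 <= i < n.+1) e i = \prod_(1 <= i < n.+1) e' i.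
    by apply: eq_big_nat => i /andP[_ ilen]; rewrite /e' -ltnS ilen.
  rewrite -(H n (leqnn n) g' e').
  - apply: eq_integral => w _; congr EFin.
    by apply: eq_big_nat => i /andP[_ ilen]; rewrite /g' -ltnS ilen.
  - by move=> i; rewrite /g'; case: leqP => [|_]; [left|right; exists setT].
  - by move=> i; rewrite /g'; case: leqP => // _; exact: measurable_indic.
  - by move=> i x; rewrite /g'; case: leqP.
  - move=> i; rewrite /g' /e'; case: leqP => // _.
    rewrite (eq_integral (cst 1%E)) => [|w _]; last by rewrite indicE in_setT.
    rewrite integral_cst// mul1e.
    exact: probability_setT.
elim: k => [_|k IH kn] {}g {}e gk mg g0 ge.
  pose B i := [set x | g i x = 1].
  have gB i : (0 < i)%N -> measurable (B i) /\ g i = \1_(B i).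
    move=> i0; have [|[A mA gA]] := gk i; first by rewrite leqNgt i0.
    suff -> : B i = A by [].
    rewrite /B gA; apply/seteqP; split => x /=; rewrite indicE.
      by have [/set_mem //|_ /eqP] := boolP (x \in A); rewrite eq_sym oner_eq0.
    by move=> /mem_set ->.
  pose C i := if (0 < i)%N then B i else setT.
  have mC i : measurable (C i) by rewrite /C; case: posnP => // /gB[].
  have gC i : (0 < i)%N -> g i = \1_(C i) by move=> i0; rewrite /C i0; case: (gB _ i0).
  have mXC i : measurable (X i @^-1` C i).
    by rewrite -[X in measurable X]setTI; exact: measurable_funPT.
  have eC i : (0 < i)%N -> P (X i @^-1` C i) = (e i)%:E.
    move=> i0; rewrite -ge gC//.
    by rewrite -[_ @^-1` _]setIT -(integral_indic P measurableT (mXC i)).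
  have := indep predT C mC.
  rewrite [X in P X](_ : _ = \bigcap_(i in [set` index_iota 1 n.+1]) (X i @^-1` C i)); last first.
    congr (\bigcap_(i in _) _).
    by apply/seteqP; split => i /=; rewrite mem_index_iota ltnS andbT.
  rewrite (eq_big_nat _ _ (F2 := fun i => (e i)%:E)); last first.
    by move=> i /andP[i0 _]; rewrite eC.
  rewrite prodEFin => <-.
  transitivity (\int[P]_w (\1_(\bigcap_(i in [set` index_iota 1 n.+1]) (X i @^-1` C i)) w : R)%:E)%E.
    apply: eq_integral => w _; congr EFin; rewrite -prod_indic.
    by apply: eq_big_nat => i /andP[i0 _]; rewrite gC.
  rewrite integral_indic ?setIT//.
  by apply: bigcap_measurableType.
have kin : k.+1 \in index_iota 1 n.+1 by rewrite mem_index_iota; apply/andP.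
rewrite (bigD1_seq k.+1) ?iota_uniq//=.
pose H w := \prod_(1 <= i < n.+1 | i != k.+1) g i (X i w).
pose c := \prod_(1 <= i < n.+1 | i != k.+1) e i.
have e0 i : 0 <= e i by rewrite -lee_fin -ge integral_ge0// => w _; rewrite lee_fin.
have c0 : 0 <= c by rewrite prodr_ge0.
have XY i (f : R -> R) : measurable_fun setT f -> measurable_fun setT (f \o X i).
  by move=> mf; apply: measurableT_comp.
have mH : measurable_fun setT H.
  rewrite /H; under eq_fun do rewrite big_mkcond.
  by apply: measurable_prod => i _; case: (i != k.+1) => //; exact: XY.
have H0 w : 0 <= H w by rewrite prodr_ge0.
transitivity (\int[P]_w (H w * g k.+1 (X k.+1 w))%:E)%E.
  by apply: eq_integral => w _; rewrite (bigD1_seq k.+1) ?iota_uniq//= mulrC.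
rewrite (@integral_density _ _ _ _ _ P (mscale (NngNum c0) (distribution P (X k.+1)))) //.
  rewrite ge0_integral_mscale//=; last 2 first.
  - exact/measurable_EFinP.
  - by move=> x _; rewrite lee_fin.
  rewrite ge0_integral_distribution; last 2 first.
  - exact/measurable_EFinP.
  - by move=> x; rewrite lee_fin.
  by rewrite /= ge -EFinM mulrC.
move=> B mB.
transitivity (c%:E * P (X k.+1 @^-1` B))%E; last by [].
pose g' i := if i == k.+1 then \1_B else g i.
pose e' i := if i == k.+1 then fine (P (X k.+1 @^-1` B)) else e i.
have mXB : measurable (X k.+1 @^-1` B).
  by rewrite -[X in measurable X]setTI; exact: measurable_funPT.
have := IH (ltnW kn) g' e'.
have e'k : e' k.+1 = fine (P (X k.+1 @^-1` B)) by rewrite /e' eqxx.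
have g'k : g' k.+1 = \1_B by rewrite /g' eqxx.
rewrite !(bigD1_seq k.+1) ?iota_uniq//= e'k.
have -> : \prod_(1 <= i < n.+1 | i != k.+1) e' i = c.
  by apply: eq_bigr => i /negbTE ik; rewrite /e' ik.
rewrite EFinM fineK ?fin_num_measure// muleC => <-.
- apply: eq_integral => w _; rewrite (bigD1_seq k.+1) ?iota_uniq//= mulrC.
  rewrite g'k; congr (_ * _)%:E.
  by apply: eq_bigr => i /negbTE ik; rewrite /g' ik.
- move=> i; rewrite /g'; have [->|ik] := eqVneq i k.+1; first by right; exists B.
  by have [h|] := gk i; [left; lia|right].
- by move=> i; rewrite /g'; case: ifP => // _; exact: measurable_indic.
- by move=> i x; rewrite /g'; case: ifP.
- move=> i; rewrite /g' /e'; case: ifP => // /eqP ->.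
  by rewrite fineK ?fin_num_measure// -[X k.+1 @^-1` _]setIT -(integral_indic P measurableT mXB).
Qed.

End independence.

(** * Tails of Gaussian sums *)

Section gaussian.
Context d (T : measurableType d) (R : realType) (P : probability T R).

(** Completing the square. *)
Lemma expR_normal_pdf (l x : R) :
  normal_pdf 0 1 x * expR (l * x) = expR (l ^+ 2 / 2) * normal_pdf l 1 x.
Proof.
rewrite !normal_pdfE ?oner_neq0// mulrCA -mulrA; congr (_ * _).
rewrite mulrC /normal_fun -!expRD; congr expR.
by rewrite expr1n subr0; lra.
Qed.

Lemma expectation_expR_normal (X : {RV P >-> R}) (l : R) :
  (forall A, measurable A -> distribution P X A = normal_prob 0 1 A) ->
  (\int[P]_w (expR (l * X w))%:E = (expR (l ^+ 2 / 2))%:E)%E.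
Proof.
move=> XN.
have mE : measurable_fun setT (fun x : R => expR (l * x)).
  by apply: measurableT_comp => //; exact: mulrl_measurable.
rewrite -(@ge0_integral_distribution _ _ _ _ _ P X (fun x => (expR (l * x))%:E));
  [|exact/measurable_EFinP|by move=> x; rewrite lee_fin expR_ge0].
rewrite -(@integral_density _ _ _ _ _ lebesgue_measure (distribution P X) idfun (normal_pdf 0 1))//.
- under eq_integral do rewrite /= expR_normal_pdf EFinM.
  rewrite ge0_integralZl_EFin//.
  + by rewrite integral_normal_pdf mule1.
  + by move=> x _; rewrite lee_fin normal_pdf_ge0.
  + by apply/measurable_EFinP; exact: measurable_normal_pdf.
- by move=> _ B mB; rewrite setTI.
- exact: measurable_normal_pdf.
- by move=> x; exact: normal_pdf_ge0.
- move=> B mB; transitivity (normal_prob 0 1 B); last exact/esym/XN.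
  rewrite /normal_prob [RHS]integral_mkcond.
  by apply: eq_integral => x _; rewrite epatch_indic /= EFinM.
Qed.

Lemma prob_le_integral (A : set T) (f : T -> R) : measurable A ->
  measurable_fun setT f -> (forall w, 0 <= f w) -> (forall w, A w -> 1 <= f w) ->
  (P A <= \int[P]_w (f w)%:E)%E.
Proof.
move=> mA mf f0 f1; rewrite -[A]setIT -(integral_indic P measurableT mA).
apply: ge0_le_integral => //.
- exact/measurable_EFinP.
- exact/measurable_EFinP.
- move=> w _; rewrite lee_fin indicE.
  by have [/set_mem/f1|] := boolP (w \in A).
Qed.

(** Chernoff's bound, with the optimal parameter y / V. *)
Lemma gaussian_sum_tail (n : nat) (eps : nat -> {RV P >-> R}) (c : nat -> R)
    (V y : R) : iid_standard_gaussian n eps ->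
  0 < V -> \sum_(1 <= i < n.+1) c i ^+ 2 <= V -> 0 <= y ->
  (P [set w | y <= \sum_(1 <= i < n.+1) c i * eps i w]%R <=
   (expR (- (y ^+ 2 / (2 * V))))%:E)%E.
Proof.
move=> [indep gauss] V0 cV y0; pose l := y / V.
have l0 : 0 <= l by rewrite divr_ge0// ltW.
pose S w := \sum_(1 <= i < n.+1) c i * eps i w.
have mS : measurable_fun setT S.
  by apply: measurable_sum => i; apply: measurable_funM.
apply: (@le_trans _ _ (\int[P]_w (expR (l * S w - l * y))%:E)%E).
  apply: prob_le_integral.
  - by apply: measurable_le_set.
  - apply: measurableT_comp => //; apply: measurable_funB => //.
    exact: measurable_funM.
  - by move=> w; exact: expR_ge0.
  - by move=> w /= yS; rewrite -mulrBr -[leLHS]expR0 ler_expR mulr_ge0// subr_ge0.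
have -> : (\int[P]_w (expR (l * S w - l * y))%:E =
    (expR (- (l * y)))%:E * \int[P]_w (expR (l * S w))%:E)%E.
  rewrite -ge0_integralZl_EFin ?expR_ge0//.
  - by apply: eq_integral => w _; rewrite addrC expRD EFinM.
  - apply/measurable_EFinP; apply: measurableT_comp => //; exact: measurable_funM.
(* weight 0 outside 1, .., n, where the law of eps is not given *)
pose c' i := if (1 <= i <= n)%N then l * c i else 0.
have -> : (\int[P]_w (expR (l * S w))%:E =
   \int[P]_w (\prod_(1 <= i < n.+1) expR (c' i * eps i w))%:E)%E.
  apply: eq_integral => w _; congr EFin; rewrite -expR_sum; congr expR.
  rewrite mulr_sumr; apply: eq_big_nat => i iin.
  by rewrite /c' -[(i <= n)%N]ltnS iin mulrA.
rewrite (@expectation_prod_independent _ _ _ _ n eps (fun i x => expR (c' i * x))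
   (fun i => expR (c' i ^+ 2 / 2)) indep); last 3 first.
- by move=> i; apply: measurableT_comp => //; exact: mulrl_measurable.
- by move=> i x; exact: expR_ge0.
- move=> i; rewrite /c'; case: ifPn => [iin|_].
    by apply: expectation_expR_normal => A mA; exact: gauss.
  rewrite (eq_integral (cst 1%E)) => [|w _]; last by rewrite mul0r expR0.
  rewrite integral_cst// mul1e expr0n /= mul0r expR0; exact: probability_setT.
rewrite -expR_sum -EFinM -expRD lee_fin ler_expR -mulr_suml.
have -> : \sum_(1 <= i < n.+1) c' i ^+ 2 = l ^+ 2 * \sum_(1 <= i < n.+1) c i ^+ 2.
  rewrite mulr_sumr; apply: eq_big_nat => i iin.
  by rewrite /c' -[(i <= n)%N]ltnS iin exprMn.
have h : l ^+ 2 * \sum_(1 <= i < n.+1) c i ^+ 2 <= l ^+ 2 * V.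
  by apply: ler_wpM2l => //; exact: sqr_ge0.
have lV : l * V = y by rewrite divfK// gt_eqF.
have -> : y ^+ 2 / (2 * V) = l * y / 2.
  by rewrite /l invfM expr2; lra.
have : l ^+ 2 * V = l * y by rewrite expr2 -mulrA lV.
lra.
Qed.

(** The crude constant 8 comes from x^2 <= 2 (e^x + e^-x) and the exponential
    moments; only finiteness matters, for Markov's inequality. *)
Lemma expectation_sqr_normal_le (X : {RV P >-> R}) :
  (forall A, measurable A -> distribution P X A = normal_prob 0 1 A) ->
  (\int[P]_w ((X w) ^+ 2)%:E <= 8%:E)%E.
Proof.
move=> XN.
have mexp l : measurable_fun setT (fun w => expR (l * X w)).
  by apply: measurableT_comp => //; exact: measurable_funM.
apply: (@le_trans _ _ (\int[P]_w (2 * expR (1 * X w) + 2 * expR (-1 * X w))%:E)%E).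
  apply: ge0_le_integral => //.
  - by move=> w _; rewrite lee_fin sqr_ge0.
  - by apply/measurable_EFinP; exact: measurable_funX.
  - by apply/measurable_EFinP; apply: measurable_funD; apply: measurable_funM.
  - move=> w _; rewrite lee_fin mul1r mulN1r.
    have h (x : R) : 0 <= x -> x ^+ 2 <= 2 * expR x.
      by move=> x0; have := expR_ge1Dxn 1 x0; rewrite (_ : 2`!%:R = 2 :> R)//; lra.
    have := expR_ge0 (X w); have := expR_ge0 (- X w).
    have [/h|/ltW x0] := leP 0 (X w); first lra.
    by have := h (- X w); rewrite oppr_ge0 sqrrN => /(_ x0); lra.
under eq_integral do rewrite EFinD.
rewrite ge0_integralD//; last 2 first.
- by apply/measurable_EFinP; apply: measurable_funM.
- by apply/measurable_EFinP; apply: measurable_funM.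
under eq_integral do rewrite EFinM.
under [X in (_ + X)%E]eq_integral do rewrite EFinM.
rewrite !ge0_integralZl_EFin//; try by move=> w _; rewrite lee_fin expR_ge0.
- rewrite !expectation_expR_normal// sqrrN expr1n -!EFinM -EFinD lee_fin.
  have e0 : 0 < expR (1 / 2 : R) by exact: expR_gt0.
  have := expR_ge1Dx (- (1 / 2) : R); rewrite expRN => h.
  have : expR (1 / 2) * (expR (1 / 2))^-1 = 1 :> R by rewrite divff// gt_eqF.
  nra.
- exact/measurable_EFinP.
- exact/measurable_EFinP.
Qed.

End gaussian.

(** * Uniform fluctuations of the averaged noise *)

Lemma sum_pairs (R : realType) (F : nat -> R) (m : nat) :
  \sum_(1 <= i < m.+1) (F (2 * i).-1 + F (2 * i)%N) =
  \sum_(1 <= r < (2 * m).+1) F r.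
Proof.
elim: m => [|m IH]; first by rewrite muln0 !big_geq.
rewrite big_nat_recr// IH (_ : 2 * m.+1 = (2 * m).+2)%N; last by rewrite mulnS.
by rewrite [RHS]big_nat_recr//= [X in _ = X + _]big_nat_recr//= addrA.
Qed.

Section union_bound.
Context d (T : measurableType d) (R : realType) (P : probability T R).

Lemma measurable_bigsetU_seq (I : Type) (r : seq I) (A : I -> set T) :
  (forall i, measurable (A i)) -> measurable (\big[setU/set0]_(i <- r) A i).
Proof. by move=> mA; elim/big_rec: _ => // i B _ mB; exact: measurableU. Qed.

Lemma union_bound (I : Type) (r : seq I) (A : I -> set T) (c : R) :
  (forall i, measurable (A i)) -> (forall i, (P (A i) <= c%:E)%E) ->
  (P (\big[setU/set0]_(i <- r) A i) <= ((size r)%:R * c)%:E)%E.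
Proof.
move=> mA Ac; elim: r => [|i r IH]; first by rewrite big_nil measure0 mul0r.
rewrite big_cons; apply: (le_trans (measureU2 _ _ _)) => //.
  exact: measurable_bigsetU_seq.
by rewrite /= -natr1 mulrDl mul1r addrC EFinD leeD.
Qed.

Lemma prob_ge_of_good (A B : set T) (eta : R) : measurable A -> measurable B ->
  ~` B `<=` A -> (P B <= eta%:E)%E -> ((1 - eta)%:E <= P A)%E.
Proof.
move=> mA mB BA PB.
apply: (@le_trans _ _ (P (~` B))); last first.
  by apply: le_measure => //; rewrite inE//; exact: measurableC.
rewrite probability_setC// EFinB; apply: leeB => //.
Qed.

End union_bound.

Section fluctuations.
Context d (T : measurableType d) (R : realType) (P : probability T R).

Lemma partial_sum_epsbar (e : nat -> R) j :
  partial_sum (epsbar e) j = \sum_(1 <= r < (2 * j).+1) (Num.sqrt 2)^-1 * e r.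
Proof.
rewrite -sum_pairs; apply: eq_bigr => l _.
by rewrite /epsbar mulrC mulrDr.
Qed.

(** The weight of the r-th noise variable in the sum of the averaged noises of
    index i+1, .., j. *)
Definition block_weight (i j r : nat) : R :=
  if (2 * i < r <= 2 * j)%N then (Num.sqrt 2)^-1 else 0.

Lemma sum_block (F : nat -> R) (a b n : nat) : (a <= b)%N -> (b <= n)%N ->
  \sum_(1 <= r < n.+1) (if (a < r <= b)%N then F r else 0) =
  \sum_(a.+1 <= r < b.+1) F r.
Proof.
move=> ab bn; rewrite (@big_cat_nat _ _ _ a.+1 1 n.+1)//= ?ltnS ?(leq_trans ab bn)//.
rewrite (@big_cat_nat _ _ _ b.+1 a.+1 n.+1)//= ?ltnS//.
rewrite big1_seq ?add0r => [|r /andP[_]]; last first.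
  by rewrite mem_index_iota ltnS => /andP[_ ra]; rewrite ltnNge ra.
rewrite [X in _ + X]big1_seq ?addr0 => [|r /andP[_]]; last first.
  by rewrite mem_index_iota => /andP[br _]; rewrite (leqNgt r b) br andbF.
by apply: eq_big_nat => r; rewrite ltnS => ->.
Qed.

Lemma partial_sum_epsbarB (e : nat -> R) (i j n : nat) :
  (i <= j)%N -> (2 * j <= n)%N ->
  partial_sum (epsbar e) j - partial_sum (epsbar e) i =
  \sum_(1 <= r < n.+1) block_weight i j r * e r.
Proof.
move=> ij jn; have ij2 : (2 * i <= 2 * j)%N by rewrite leq_mul2l.
rewrite !partial_sum_epsbar.
rewrite (@big_cat_nat _ _ _ (2 * i).+1) ?ltnS ?leq_mul2l//= addrAC subrr add0r.
rewrite -(sum_block _ ij2 jn); apply: eq_bigr => r _.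
by rewrite /block_weight; case: ifP => // _; rewrite mul0r.
Qed.

Lemma sum_block_weight_sqr (i j n : nat) : (i <= j)%N -> (2 * j <= n)%N ->
  \sum_(1 <= r < n.+1) block_weight i j r ^+ 2 = (j - i)%:R.
Proof.
move=> ij jn; have ij2 : (2 * i <= 2 * j)%N by rewrite leq_mul2l.
transitivity (\sum_((2 * i).+1 <= r < (2 * j).+1) (2^-1 : R)).
  rewrite -(sum_block _ ij2 jn); apply: eq_bigr => r _.
  rewrite /block_weight; case: ifP => // _; last by rewrite expr0n.
  by rewrite exprVn sqr_sqrtr.
by rewrite sumr_const_nat subSS -mulnBr -[LHS]mulr_natr natrM mulrA mulVf ?mul1r//.
Qed.

(** With this level x, n^2 pairs of two-sided Gaussian tails 2 exp (- x^2 / 2)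
    add up to eta. *)
Definition noise_level (n : nat) (eta : R) : R :=
  Num.sqrt (4 * ln n%:R + 2 * ln (2 / eta)).

(** A normalised sum of the averaged noises over any block is a standard
    Gaussian variable, and there are fewer than n^2 blocks. *)
Lemma noise_fluctuation (n m : nat) (eps : nat -> {RV P >-> R}) (eta : R) :
  iid_standard_gaussian n eps -> n = (2 * m)%N -> (0 < m)%N -> 0 < eta <= 1 ->
  exists Bad : set T, [/\ measurable Bad, (P Bad <= eta%:E)%E &
    forall w, ~ Bad w -> forall i j, (i < j <= m)%N ->
      `|partial_sum (epsbar (eps ^~ w)) j - partial_sum (epsbar (eps ^~ w)) i| <=
      noise_level n eta * Num.sqrt (j - i)%:R].
Proof.
move=> iid nm m0 /andP[eta0 eta1].
set x := noise_level n eta.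
have x0 : 0 <= x by exact: sqrtr_ge0.
have n1 : 1 <= n%:R :> R by rewrite ler1n nm; lia.
have n0 : 0 < n%:R :> R by lra.
have lnn : 0 <= ln (n%:R : R) by exact: ln_ge0.
have lne : 0 <= ln (2 / eta) by apply: ln_ge0; rewrite ler_pdivlMr//; lra.
have x2 : x ^+ 2 = 4 * ln n%:R + 2 * ln (2 / eta) by rewrite sqr_sqrtr//; lra.
pose D i j w := partial_sum (epsbar (eps ^~ w)) j - partial_sum (epsbar (eps ^~ w)) i.
pose A (p : 'I_m.+1 * 'I_m.+1) := if (p.1 < p.2)%N then
  [set w | x * Num.sqrt (p.2 - p.1)%:R < `|D p.1 p.2 w|] else set0.
have jn (j : 'I_m.+1) : (2 * j <= n)%N by rewrite nm leq_mul2l -ltnS ltn_ord.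
have mDs (i j : 'I_m.+1) : (i < j)%N -> measurable_fun setT (D i j).
  move=> ij; rewrite (_ : D i j = fun w =>
      \sum_(1 <= r < n.+1) block_weight i j r * eps r w); last first.
    by apply/funext => w; rewrite /D (partial_sum_epsbarB _ (ltnW ij) (jn j)).
  by apply: measurable_sum => r; apply: measurable_funM.
have mA p : measurable (A p).
  rewrite /A; case: ifPn => // ij; apply: measurable_lt_set => //.
  by apply: measurableT_comp => //; exact: mDs.
pose q : R := 2 * expR (- (x ^+ 2 / 2)).
have PA p : (P (A p) <= q%:E)%E.
  rewrite /A; case: ifPn => [ij|_]; last first.
    by rewrite measure0 lee_fin mulr_ge0// expR_ge0.
  set i := p.1 in ij *; set j := p.2 in ij *.
  have V0 : 0 < (j - i)%:R :> R by rewrite ltr0n subn_gt0.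
  set y := x * _; have y0 : 0 <= y by rewrite mulr_ge0// sqrtr_ge0.
  have yV : y ^+ 2 / (2 * (j - i)%:R) = x ^+ 2 / 2.
    have -> : y ^+ 2 = x ^+ 2 * (j - i)%:R.
      by rewrite exprMn; congr (_ * _); apply: sqr_sqrtr; exact: ltW.
    by rewrite invfM mulrACA mulfV ?mulr1// gt_eqF.
  have Sq := sum_block_weight_sqr (ltnW ij) (jn j).
  pose S s w := \sum_(1 <= r < n.+1) (s * block_weight i j r) * eps r w.
  have mS s : measurable [set w | y <= S s w].
    apply: measurable_le_set => //; apply: measurable_sum => r.
    exact: measurable_funM.
  have PS s : s ^+ 2 = 1 -> (P [set w | y <= S s w]%R <= (expR (- (x ^+ 2 / 2)))%:E)%E.
    move=> s1; rewrite -yV; apply: gaussian_sum_tail => //.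
    by under eq_bigr do rewrite exprMn s1 mul1r; rewrite Sq.
  have SE s w : S s w = s * D i j w.
    rewrite /D (partial_sum_epsbarB _ (ltnW ij) (jn j)) mulr_sumr.
    by apply: eq_bigr => r _; rewrite mulrA.
  apply: (@le_trans _ _ (P ([set w | y <= S 1 w]%R `|` [set w | y <= S (-1) w]%R))).
    apply: le_measure; rewrite ?inE.
    - by have := mA p; rewrite /A ij.
    - by apply: measurableU; apply: mS.
    - move=> w /= h; rewrite !SE mul1r mulN1r.
      have [D0|/ltW D0] := leP 0 (D i j w); [left|right].
        by move: h; rewrite ger0_norm// => /ltW.
      by move: h; rewrite ler0_norm// => /ltW.
  apply: (le_trans (measureU2 _ _ _)) => //.
  by rewrite /q mulr_natl mulr2n EFinD leeD// PS// ?expr1n// sqrrN expr1n.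
exists (\big[setU/set0]_(p <- enum {: 'I_m.+1 * 'I_m.+1}) A p); split.
- exact: measurable_bigsetU_seq.
- apply: (le_trans (union_bound _ mA PA)); rewrite lee_fin.
  rewrite -cardE card_prod !card_ord.
  have e : expR (- (x ^+ 2 / 2)) = (n%:R ^+ 2)^-1 * (eta / 2).
    rewrite x2 (_ : - _ = - (2 * ln n%:R) + - ln (2 / eta)); last by lra.
    rewrite expRD !expRN lnK ?posrE ?divr_gt0// invf_div; congr (_^-1 * _).
    by rewrite (_ : 2 * _ = ln n%:R + ln n%:R); [rewrite expRD lnK ?posrE|lra].
  rewrite /q e natrM -expr2.
  have mn : m.+1%:R <= n%:R :> R by rewrite ler_nat nm; lia.
  have : m.+1%:R ^+ 2 <= n%:R ^+ 2 :> R by rewrite lerXn2r// nnegrE ler0n.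
  have : (n%:R ^+ 2)^-1 * n%:R ^+ 2 = 1 :> R by rewrite mulVf// expf_neq0// gt_eqF.
  have : 0 < (n%:R ^+ 2)^-1 :> R by rewrite invr_gt0 exprn_gt0.
  set a := (n%:R ^+ 2)^-1; set b := n%:R ^+ 2; set c := m.+1%:R ^+ 2 => a0 ab cb.
  have : a * c <= 1 by rewrite -ab ler_wpM2l// ltW.
  nra.
- move=> w nB i j /andP[ij jm]; rewrite leNgt; apply/negP => h; apply: nB.
  have im : (i < m.+1)%N by lia.
  have jm' : (j < m.+1)%N by lia.
  rewrite -bigcup_seq; exists (Ordinal im, Ordinal jm') => /=.
    by rewrite mem_enum.
  by rewrite /A /= ij.
Qed.

End fluctuations.

(** * Lower tail of the chi-square law *)

Section chi_square.
Context (R : realType).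
Local Notation mu := (@lebesgue_measure R).

Lemma ge0_integral_lebesgue_scale (c : R) (f : R -> R) : 0 < c ->
  measurable_fun setT f -> (forall x, 0 <= f x) ->
  (\int[mu]_x (f x)%:E = c%:E * \int[mu]_x (f (c * x))%:E)%E.
Proof.
move=> c0 mf f0.
pose phi (x : measurableTypeR R) : measurableTypeR R := c * x.
have mphi : measurable_fun setT phi by exact: mulrl_measurable.
have scaled A : measurable A -> mu A = (c%:E * mu (phi @^-1` A))%E.
  move=> mA; unshelve (apply: (@lebesgue_measure_unique R
    (mscale (NngNum (ltW c0)) (pushforward mu phi)))) => // _ [[a b] _ <-].
  transitivity (c%:E * mu (phi @^-1` `]a, b]%classic))%E; last by [].
  rewrite [X in (_ * lebesgue_measure X)%E](_ : _ = `]a / c, b / c]%classic); last first.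
    apply/seteqP; split => x /=; rewrite !in_itv /= /phi ltr_pdivrMr// ler_pdivlMr//;
      by rewrite [x * c]mulrC.
  rewrite !lebesgue_measure_itv /= !lte_fin ltr_pM2r ?invr_gt0//.
  case: ifPn => _; last by rewrite mule0.
  rewrite -!EFinB -EFinM -mulrBl; congr EFin.
  by rewrite mulrC divfK// gt_eqF.
have mfE : measurable_fun setT (fun x : measurableTypeR R => (f x)%:E).
  exact/measurable_EFinP.
have fE0 y : (0 <= (f y)%:E)%E by rewrite lee_fin.
have := ge0_integral_pushforward mphi mu measurableT mfE (fun y _ => fE0 y).
rewrite preimage_setT => <-.
rewrite -[c]/((NngNum (ltW c0))%:num) -ge0_integral_mscale//.
by apply: eq_measure_integral => A mA _; exact: (scaled A mA).
Qed.

Lemma Gamma_ge0 (a : R) : 0 <= Gamma a.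
Proof.
apply: Rintegral_ge0 => x _; rewrite mulr_ge0 ?powR_ge0 ?expR_ge0//.
Qed.

Lemma chi_square_pdf_ge0 k (x : R) : 0 <= chi_square_pdf k x.
Proof.
rewrite /chi_square_pdf; case: ifP => // x0.
by rewrite divr_ge0// mulr_ge0 ?powR_ge0 ?expR_ge0 ?Gamma_ge0.
Qed.

Lemma measurable_chi_square_pdf k : measurable_fun setT (@chi_square_pdf R k).
Proof.
apply: measurable_fun_ifT => //; first exact: measurable_fun_ltr.
apply: measurable_funM => //; apply: measurable_funM => //.
apply: measurableT_comp => //; apply: measurable_funM => //.
Qed.

(** Dividing the argument by e^2 makes the density comparable to itself; this
    gives the lower tail by a change of variable, without computing any moment
    nor the normalising constant. *)
Lemma chi_square_pdf_scale k (x : R) : 0 < x ->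
  expR (- 2) * chi_square_pdf k (expR (- 2) * x) =
  expR (- k%:R) * expR ((1 - expR (- 2)) * x / 2) * chi_square_pdf k x.
Proof.
move=> x0; rewrite /chi_square_pdf x0 mulr_gt0 ?expR_gt0//.
set a := k%:R / 2 - 1; set K := _ * Gamma _.
have -> : (expR (- 2) * x) `^ a = expR (a * - 2) * x `^ a.
  by rewrite powRM ?expR_ge0 1?ltW// [in LHS]/powR gt_eqF ?expR_gt0// expRK.
have e : expR (- 2) * expR (a * - 2) * expR (- (expR (- 2) * x) / 2) =
    expR (- k%:R) * expR ((1 - expR (- 2)) * x / 2) * expR (- x / 2).
  by rewrite -!expRD; congr expR; set c := expR _; rewrite /a; lra.
have := congr1 (fun z => z * (x `^ a / K)) e.
lra.
Qed.

End chi_square.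

Section chi_square_tail.
Context d (T : measurableType d) (R : realType) (P : probability T R).

(** On the event considered the ratio of densities of the previous lemma is at
    most e^-k e^(k/2), and the density has total mass 1. *)
Lemma chi_square_lower_tail (k : nat) (X : {RV P >-> R}) :
  has_chi_square_law k X ->
  (P [set w | X w <= expR (- 2) * k%:R]%R <= (expR (- (k%:R / 2)))%:E)%E.
Proof.
move=> XL; set c : R := expR (- 2); set t := c * k%:R.
have c0 : 0 < c by exact: expR_gt0.
have c1 : c <= 1 by rewrite -expR0 ler_expR; lra.
pose f x : R := chi_square_pdf k x * \1_(`]-oo, t]) x.
have mpdf := @measurable_chi_square_pdf R k.
have f0 x : 0 <= f x by rewrite mulr_ge0 ?chi_square_pdf_ge0.
have mf : measurable_fun setT f by apply: measurable_funM.
have -> : P [set w | X w <= t] = (\int[@lebesgue_measure R]_x (f x)%:E)%E.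
  have -> : [set w | X w <= t] = X @^-1` `]-oo, t].
    by apply/seteqP; split => w /=; rewrite in_itv.
  have := XL `]-oo, t]%classic (measurable_itv _); rewrite /distribution /pushforward => ->.
  rewrite integral_mkcond; apply: eq_integral => x _.
  by rewrite epatch_indic /f EFinM.
rewrite (ge0_integral_lebesgue_scale c0)// -ge0_integralZl_EFin ?(ltW c0)//; last 2 first.
- by move=> x _; rewrite lee_fin.
- apply/measurable_EFinP; apply: measurableT_comp => //; exact: mulrl_measurable.
have -> : (expR (- (k%:R / 2)))%:E =
    (\int[@lebesgue_measure R]_x (expR (- (k%:R / 2)) * chi_square_pdf k x)%:E)%E.
  under eq_integral do rewrite EFinM.
  rewrite ge0_integralZl_EFin ?expR_ge0//; last 2 first.
  - by move=> x _; rewrite lee_fin chi_square_pdf_ge0.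
  - exact/measurable_EFinP.
  have := XL setT measurableT; rewrite /distribution /pushforward preimage_setT.
  by rewrite probability_setT => <-; rewrite mule1.
apply: ge0_le_integral => //.
- by move=> x _; rewrite mule_ge0// lee_fin// ltW.
- apply: measurable_funeM; apply/measurable_EFinP.
  by apply: measurableT_comp => //; exact: mulrl_measurable.
- by apply/measurable_EFinP; exact: measurable_funM.
move=> x _; rewrite -EFinM lee_fin /f.
have [x0|x0] := leP x 0.
  have -> : chi_square_pdf k (c * x) = 0.
    by rewrite /chi_square_pdf ifN// -leNgt mulr_ge0_le0// ltW.
  by rewrite mul0r mulr0 mulr_ge0 ?expR_ge0 ?chi_square_pdf_ge0.
rewrite indicE; have [|_] := boolP (_ \in _); last first.
  by rewrite !mulr0 mulr_ge0 ?expR_ge0 ?chi_square_pdf_ge0.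
rewrite inE /= in_itv /= /t ler_pM2l// => xk.
rewrite mulr1 /c chi_square_pdf_scale// ler_wpM2r ?chi_square_pdf_ge0//.
rewrite -expRD ler_expR -/c; nra.
Qed.

End chi_square_tail.

(** * Measurability of the statistics and size of the threshold *)

Section measurability.
Context d (T : measurableType d) (R : realType).

Lemma measurable_Ybar (Y : nat -> T -> R) l :
  (forall i, measurable_fun setT (Y i)) ->
  measurable_fun setT (fun w => Ybar (Y ^~ w) l).
Proof. by move=> mY; apply: measurable_funM => //; exact: measurable_funD. Qed.

Lemma measurable_epsbar (e : nat -> T -> R) l :
  (forall i, measurable_fun setT (e i)) ->
  measurable_fun setT (fun w => epsbar (e ^~ w) l).
Proof. by move=> mY; apply: measurable_funM => //; exact: measurable_funD. Qed.

Lemma measurable_sigma02_hat n (Y : nat -> T -> R) :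
  (forall i, measurable_fun setT (Y i)) ->
  measurable_fun setT (fun w => sigma02_hat n (Y ^~ w)).
Proof.
move=> mY; rewrite /sigma02_hat /sigma2_hat; apply: measurable_funM => //.
apply: measurable_funM => //; apply: measurable_sum => i.
by apply: measurable_funX; exact: measurable_funB.
Qed.

Lemma measurable_Z_reg n (e : nat -> T -> R) :
  (forall i, measurable_fun setT (e i)) ->
  measurable_fun setT (fun w => Z_reg n (e ^~ w)).
Proof.
move=> me; apply: (@measurable_max_grid _ _ _ _ (fun w a b => _)) => i j ij.
apply: measurable_funM => //.
apply: (@measurable_sup_gap _ _ _ _ _ _ (fun l w => epsbar (e ^~ w) l)) => // l.
exact: measurable_epsbar.
Qed.

Lemma measurable_max_S_reg n (Y : nat -> T -> R) :
  (forall i, measurable_fun setT (Y i)) ->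
  measurable_fun setT (fun w => max_grid n./2 (S_reg n (Y ^~ w))).
Proof.
move=> mY; apply: (@measurable_max_grid _ _ _ _ (fun w a b => _)) => i j ij.
apply: measurable_funM => //.
  apply: (measurableT_comp (@measurable_sqrt R)); apply: measurable_funM => //.
  apply: (measurableT_comp (@measurable_inv R)); apply: measurable_funM => //.
  exact: measurable_sigma02_hat.
apply: (@measurable_sup_gap _ _ _ _ _ _ (fun l w => Ybar (Y ^~ w) l)) => // l.
exact: measurable_Ybar.
Qed.

End measurability.

Lemma sqrt_grid (R : realType) (m i j : nat) : (0 < m)%N -> (i < j)%N ->
  Num.sqrt (m%:R / (j%:R / m%:R - i%:R / m%:R)) =
  m%:R / Num.sqrt (j - i)%:R :> R.
Proof.
move=> m0 ij; rewrite -mulrBl -natrB 1?ltnW// invfM invrK mulrA.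
have m0' : 0 <= m%:R :> R by [].
by rewrite [_ * m%:R]mulrAC -expr2 sqrtrM ?sqr_ge0// sqrtr_sqr ger0_norm// sqrtrV.
Qed.

Section threshold.
Context d (T : measurableType d) (R : realType) (P : probability T R).

Lemma Z_reg_le (n m : nat) (e : nat -> R) (x : R) : n = (2 * m)%N -> (0 < m)%N ->
  0 <= x ->
  (forall i j, (i < j <= m)%N -> `|partial_sum (epsbar e) j - partial_sum (epsbar e) i|
      <= x * Num.sqrt (j - i)%:R) ->
  Z_reg n e <= 2 * x.
Proof.
move=> nm m0 x0 H; have e2 : n./2 = m by rewrite nm mul2n doubleK.
have mR : 0 < m%:R :> R by rewrite ltr0n.
rewrite /Z_reg /max_grid e2; apply: bigmax_le => [|[i j] /= ij]; first by lra.
have jm : (j <= m)%N by rewrite -ltnS.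
have d0 : 0 < (j - i)%:R :> R by rewrite ltr0n subn_gt0.
have sd0 : 0 < Num.sqrt (j - i)%:R :> R by rewrite sqrtr_gt0.
rewrite sqrt_grid//.
have : sup_gap (i%:R / m%:R) (j%:R / m%:R) (cusum m (epsbar e)) <=
    2 * `|x * Num.sqrt (j - i)%:R| / m%:R.
  apply: sup_gap_cusum_le (ltnW ij) _ => // k /andP[ik kj].
  apply: (le_trans (H i k _)); first by rewrite ik (leq_trans kj).
  by rewrite ler_wpM2l// ler_wsqrtr// ler_nat leq_sub2r.
rewrite ger0_norm ?mulr_ge0 ?(ltW sd0)//.
move=> h; apply: (le_trans (ler_wpM2l _ h)); first by rewrite divr_ge0 ?ltW.
have e1 : m%:R / m%:R = 1 :> R by rewrite divff// gt_eqF.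
have e3 : Num.sqrt (j - i)%:R / Num.sqrt (j - i)%:R = 1 :> R by rewrite divff// gt_eqF.
have : Num.sqrt (j - i)%:R / Num.sqrt (j - i)%:R * (m%:R / m%:R) * (2 * x) = 2 * x.
  by rewrite e1 e3 !mul1r.
lra.
Qed.

(** The numerator is at most twice the noise level except on an event of
    probability alpha / 2, and the chi-square variable exceeds e^-2 m except on
    another one, because n >= 18 ln (2 / alpha). *)
Lemma threshold_le (n m : nat) (eps : nat -> {RV P >-> R}) (X : {RV P >-> R})
    (alpha : R) :
  n = (2 * m)%N -> (0 < m)%N -> 0 < alpha < 1 -> 18 * ln (2 / alpha) <= n%:R ->
  iid_standard_gaussian n eps -> has_chi_square_law m X ->
  threshold P n eps X alpha <= 2 * expR 1 * noise_level n (alpha / 2).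
Proof.
move=> nm m0 /andP[a0 a1] nln iid XL.
have e2 : n./2 = m by rewrite nm mul2n doubleK.
have mR : 0 < m%:R :> R by rewrite ltr0n.
set x := noise_level n (alpha / 2); have x0 : 0 <= x by exact: sqrtr_ge0.
have a2 : 0 < alpha / 2 <= 1 by apply/andP; split; lra.
have [Bad [mBad PBad good]] := noise_fluctuation iid nm m0 a2.
pose V w := Z_reg n (eps ^~ w) / Num.sqrt (X w / m%:R).
have mV : measurable_fun setT V.
  apply: measurable_funM; first by apply: (@measurable_Z_reg _ _ _ n eps).
  apply: (measurableT_comp (@measurable_inv R)).
  by apply: (measurableT_comp (@measurable_sqrt R)); apply: measurable_funM.
pose Low := [set w | X w <= expR (- 2) * m%:R].
have mLow : measurable Low by apply: measurable_le_set.
have PLow : (P Low <= (alpha / 2)%:E)%E.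
  apply: (le_trans (chi_square_lower_tail XL)); rewrite lee_fin.
  rewrite -[leRHS]lnK ?posrE; last by lra.
  have la : ln (2 / alpha) = - ln (alpha / 2) by rewrite -lnV ?posrE ?invf_div//; lra.
  rewrite ler_expR; move: nln; rewrite la nm natrM.
  have : 0 <= ln (2 / alpha) by apply: ln_ge0; rewrite ler_pdivlMr//; lra.
  rewrite la; lra.
have V_le w : ~ (Bad `|` Low) w -> V w <= 2 * expR 1 * x.
  move=> nB; have gw := good w (fun b => nB (or_introl b)).
  have Zle := Z_reg_le nm m0 x0 gw.
  have Xw : expR (- 2) * m%:R < X w by rewrite ltNge; apply/negP => h; apply: nB; right.
  have s0 : expR (- 1) <= Num.sqrt (X w / m%:R).
    rewrite -[leLHS]ger0_norm ?expR_ge0// -sqrtr_sqr ler_wsqrtr// ler_pdivlMr//.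
    apply: le_trans (ltW Xw); rewrite expr2 -expRD.
    by have -> : - 1 + - 1 = - 2 :> R by lra.
  have sp : 0 < Num.sqrt (X w / m%:R) by apply: lt_le_trans s0; exact: expR_gt0.
  rewrite /V ler_pdivrMr//; apply: (le_trans Zle).
  have ee : expR 1 * expR (- 1) = 1 :> R by rewrite -expRD subrr expR0.
  have : 2 * x * (expR 1 * expR (- 1)) <= 2 * x * (expR 1 * Num.sqrt (X w / m%:R)).
    by rewrite ler_wpM2l ?ler_wpM2l ?expR_ge0//; lra.
  rewrite ee; lra.
have PV : ((1 - alpha)%:E <= P [set w | V w <= 2 * expR 1 * x]%R)%E.
  apply: (@prob_ge_of_good _ _ _ P _ (Bad `|` Low)).
  - exact: measurable_le_set.
  - exact: measurableU.
  - by move=> w; exact: V_le.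
  - apply: (le_trans (measureU2 _ _ _)) => //.
    by have -> : alpha%:E = ((alpha / 2)%:E + (alpha / 2)%:E)%E;
      [rewrite -EFinD; congr EFin; lra|exact: leeD].
rewrite /threshold /quantile e2; set E := [set y | _].
have Ex : E (2 * expR 1 * x) by [].
(* the infimum of a set without lower bound is 0 by convention *)
have [lbE|nlb] := pselect (has_lbound E); first exact: ge_inf.
rewrite inf_out; last by case.
by rewrite !mulr_ge0// expR_ge0.
Qed.

End threshold.

(** * Ties and squared noises *)

Section ties.
Context d (T : measurableType d) (R : realType) (P : probability T R).

Lemma mutually_independent_pair (n i j : nat) (X : nat -> T -> R) :
  mutually_independent P n X -> (1 <= i <= n)%N -> (1 <= j <= n)%N -> i != j ->
  independent2 P (X i) (X j).
Proof.
move=> indep iin jin ij A B mA mB.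
pose C l := if l == i then A else B.
have mC l : measurable (C l) by rewrite /C; case: ifP.
have Ci : C i = A by rewrite /C eqxx.
have Cj : C j = B by rewrite /C eq_sym (negbTE ij).
have := indep (pred2 i j) C mC.
rewrite [X in P X](_ : _ = X i @^-1` A `&` X j @^-1` B); last first.
  apply/seteqP; split => w /=.
    move=> H; rewrite -Ci -Cj; split; apply: H => /=.
      by rewrite iin eqxx.
    by rewrite jin eqxx orbT.
  by move=> [Aw Bw] l /= /andP[_ /orP[/eqP ->|/eqP ->]]; rewrite ?Ci ?Cj.
move=> ->; rewrite -big_filter.
rewrite (perm_big [:: i; j]); last first.
  apply: uniq_perm; rewrite ?filter_uniq ?iota_uniq//=.
    by rewrite inE ij.
  move=> l; rewrite mem_filter mem_index_iota !inE /= ltnS.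
  by case: eqVneq => [->|_] /=; [rewrite iin|case: eqVneq => [->|//]; rewrite jin].
by rewrite !big_cons big_nil /= mule1 Ci Cj.
Qed.

(** The joint law is the product of the two laws, and each section of the
    line y - x = c is a point. *)
Lemma prob_difference_eq0 (X Y : {RV P >-> R}) (c : R) :
  independent2 P X Y -> (forall y, P (Y @^-1` [set y]) = 0%E) ->
  P [set w | Y w - X w = c] = 0%E.
Proof.
move=> XY Y0; pose Z w := (X w, Y w).
have mZ : measurable_fun setT Z by exact: measurable_fun_pair.
pose D := [set p : R * R | p.2 - p.1 = c].
have mD : measurable D.
  by apply: measurable_eq_set; apply: measurable_funB;
    [exact: measurable_snd|exact: measurable_fst].
have e A : measurable A ->
    (distribution P X \x distribution P Y)%E A = pushforward P Z A.
  move=> mA; unshelve (apply: (@product_measure_unique _ _ _ _ R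
     (distribution P X) (distribution P Y) (pushforward P Z))) => //.
have -> : P [set w | Y w - X w = c] = pushforward P Z D by [].
rewrite -e// /product_measure1 integral0_eq// => x _ /=.
rewrite /distribution /pushforward /= -[RHS](Y0 (x + c)); congr (P _).
apply/seteqP; split => w /=.
  by rewrite /xsection /= inE /D /= => <-; rewrite addrC subrK.
by move=> ->; rewrite /xsection /= inE /D /= addrC addKr.
Qed.

Lemma normal_no_atom (X : {RV P >-> R}) (y : R) :
  (forall A, measurable A -> distribution P X A = normal_prob 0 1 A) ->
  P (X @^-1` [set y]) = 0%E.
Proof.
move=> XN; have := XN [set y] (measurable_set1 y); rewrite /distribution /pushforward => ->.
exact: integral_set1.
Qed.

Lemma sum_sqr_tail (n : nat) (eps : nat -> {RV P >-> R}) (eta : R) :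
  (0 < n)%N -> iid_standard_gaussian n eps -> 0 < eta ->
  (P [set w | 8 / eta * n%:R <= \sum_(1 <= i < n.+1) eps i w ^+ 2]%R <= eta%:E)%E.
Proof.
move=> n0 [_ gauss] eta0; have nR : 0 < n%:R :> R by rewrite ltr0n.
pose q : R := eta / 8 / n%:R; have q0 : 0 < q by rewrite !divr_gt0.
have mS : measurable_fun setT (fun w => \sum_(1 <= i < n.+1) eps i w ^+ 2).
  by apply: measurable_sum => i; exact: measurable_funX.
apply: (@le_trans _ _ (\int[P]_w (q * \sum_(1 <= i < n.+1) eps i w ^+ 2)%:E)%E).
  apply: prob_le_integral.
  - exact: measurable_le_set.
  - exact: measurable_funM.
  - by move=> w; rewrite mulr_ge0 ?(ltW q0)// sumr_ge0// => i _; exact: sqr_ge0.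
  - move=> w /=; move=> /(ler_wpM2l (ltW q0)) /(le_trans _); apply.
    rewrite /q; have e1 : n%:R / n%:R = 1 :> R by rewrite divff// gt_eqF.
    have e2 : eta / eta = 1 by rewrite divff// gt_eqF.
    have : eta / eta * (n%:R / n%:R) = 1 by rewrite e1 e2 mulr1.
    lra.
under eq_integral do rewrite EFinM.
rewrite ge0_integralZl_EFin ?(ltW q0)//; last 2 first.
- by move=> w _; rewrite lee_fin sumr_ge0// => i _; exact: sqr_ge0.
- exact/measurable_EFinP.
have -> : (\int[P]_w (\sum_(1 <= i < n.+1) eps i w ^+ 2)%:E =
   \sum_(1 <= i < n.+1) \int[P]_w (eps i w ^+ 2)%:E)%E.
  under eq_integral do rewrite -sumEFin.
  rewrite ge0_integral_sum// => [i|i w _]; last by rewrite lee_fin sqr_ge0.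
  by apply/measurable_EFinP; exact: measurable_funX.
apply: (@le_trans _ _ (q%:E * (8 * n%:R)%:E)%E).
  rewrite lee_pmul2l ?lte_fin//.
  apply: (@le_trans _ _ (\sum_(1 <= i < n.+1) 8%:E)%E).
    rewrite big_seq [leRHS]big_seq; apply: lee_sum => i; rewrite mem_index_iota ltnS => iin.
    by apply: expectation_sqr_normal_le => A mA; exact: gauss.
  by rewrite sumEFin lee_fin sumr_const_nat subn1 /= mulr_natr.
rewrite -EFinM lee_fin /q.
have e1 : n%:R / n%:R = 1 :> R by rewrite divff// gt_eqF.
have : eta * (n%:R / n%:R) = eta by rewrite e1 mulr1.
lra.
Qed.

End ties.

(** * A large chord gap of the signal leads to rejection *)

Section power.
Context (R : realType).

(** The signal part of the averaged observations. *)
Definition fbar (n : nat) (f : R -> R) : nat -> R :=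
  Ybar (fun l => f (l%:R / n%:R)).

Lemma chord_gapD (A B : nat -> R) (c : R) i k j :
  chord_gap (fun l => A l + c * B l) i k j =
  chord_gap A i k j + c * chord_gap B i k j.
Proof. by rewrite /chord_gap; lra. Qed.

(** The chord gap is a convex combination of S i - S k and S j - S k. *)
Lemma chord_gap_ge (B : nat -> R) (x : R) (i k j : nat) : (i < k < j)%N ->
  (forall a b, (a < b <= j)%N -> `|B b - B a| <= x * Num.sqrt (b - a)%:R) ->
  0 <= x -> - (x * Num.sqrt (j - i)%:R) <= chord_gap B i k j.
Proof.
move=> /andP[ik kj] H x0; set M := x * _.
have h1 : `|B k - B i| <= M.
  apply: (le_trans (H _ _ _)); first by rewrite ik ltnW.
  by rewrite ler_wpM2l// ler_wsqrtr// ler_nat; lia.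
have h2 : `|B j - B k| <= M.
  apply: (le_trans (H _ _ _)); first by rewrite kj /=.
  by rewrite ler_wpM2l// ler_wsqrtr// ler_nat; lia.
have ikR : (i%:R : R) < k%:R by rewrite ltr_nat.
have kjR : (k%:R : R) < j%:R by rewrite ltr_nat.
have ji : 0 < (j%:R : R) - i%:R by lra.
move: h1 h2; rewrite !ler_norml => /andP[a1 a2] /andP[b1 b2].
rewrite /chord_gap lerBrDr ler_pdivlMr//; nra.
Qed.

Lemma Ybar_reg_obs n sigma f (e : nat -> R) l :
  Ybar (reg_obs n sigma f e) l = fbar n f l + sigma / Num.sqrt 2 * epsbar e l.
Proof.
rewrite /fbar /Ybar /epsbar /reg_obs.
have s2 : (Num.sqrt 2 : R)^-1 * (Num.sqrt 2)^-1 = 2^-1.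
  by rewrite -invfM -expr2 sqr_sqrtr.
have := congr1 (fun z => z * (sigma * (e (2 * l).-1 + e (2 * l)%N))) s2.
lra.
Qed.

Lemma partial_sum_reg_obs n sigma f (e : nat -> R) k :
  partial_sum (Ybar (reg_obs n sigma f e)) k =
  partial_sum (fbar n f) k + sigma / Num.sqrt 2 * partial_sum (epsbar e) k.
Proof.
rewrite /partial_sum mulr_sumr -big_split /=; apply: eq_bigr => l _.
exact: Ybar_reg_obs.
Qed.

(** A difference of successive observations is a signal increment, at most
    sigma, plus sigma times a difference of two noises. *)
Lemma sigma02_hat_le (n m : nat) (sigma M : R) (f : R -> R) (e : nat -> R) :
  n = (2 * m)%N -> (0 < m)%N -> 0 < sigma ->
  (forall l, (1 <= l <= m)%N ->
     `|f ((2 * l)%:R / n%:R) - f ((2 * l).-1%:R / n%:R)| <= sigma) ->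
  \sum_(1 <= r < n.+1) e r ^+ 2 <= M * n%:R ->
  sigma02_hat n (reg_obs n sigma f e) <= (1 / 2 + 2 * M) * sigma ^+ 2.
Proof.
move=> nm m0 s0 Hf He; have nR : 0 < n%:R :> R by rewrite ltr0n nm; lia.
have e2 : n./2 = m by rewrite nm mul2n doubleK.
rewrite /sigma02_hat /sigma2_hat e2.
have h : \sum_(1 <= i < m.+1) (reg_obs n sigma f e (2 * i) -
      reg_obs n sigma f e (2 * i).-1) ^+ 2 <=
    \sum_(1 <= i < m.+1) (2 * sigma ^+ 2 +
      (4 * sigma ^+ 2) * (e (2 * i).-1 ^+ 2 + e (2 * i)%N ^+ 2)).
  rewrite big_seq [leRHS]big_seq; apply: ler_sum => i; rewrite mem_index_iota ltnS => iin.
  have := Hf i iin; rewrite /reg_obs ler_norml.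
  set a := f _ - f _ => /andP[a1 a2].
  set b := e _; set c := e _.
  have -> : f ((2 * i)%:R / n%:R) + sigma * b - (f ((2 * i).-1%:R / n%:R) + sigma * c) =
     a + sigma * (b - c) by rewrite /a; lra.
  have ha : a ^+ 2 <= sigma ^+ 2 by nra.
  have := sqr_ge0 (a - sigma * (b - c)); have := sqr_ge0 (sigma * (b + c)).
  nra.
apply: (@le_trans _ _ (n%:R^-1 * (2 * sigma ^+ 2 * m%:R + 4 * sigma ^+ 2 * (M * n%:R)) / 2)).
  rewrite ler_pM2r ?invr_gt0// ler_pM2l ?invr_gt0//; apply: (le_trans h).
  rewrite big_split /=; apply: lerD; first by rewrite sumr_const_nat subn1 mulr_natr.
  rewrite -mulr_sumr (sum_pairs (fun r => e r ^+ 2)) -nm ler_wpM2l//.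
  by rewrite mulr_ge0// sqr_ge0.
have nE : n%:R = 2 * m%:R :> R by rewrite nm natrM.
have n1 : n%:R^-1 * n%:R = 1 :> R by rewrite mulVf// gt_eqF.
have := congr1 (fun z => z * (sigma ^+ 2 / 2 + 2 * sigma ^+ 2 * M)) n1.
rewrite /= {2}nE; nra.
Qed.

(** A vanishing variance estimate would make the statistics 0 by the
    convention 1 / 0 = 0; it forces a tie between the first two
    observations. *)
Lemma sigma02_hat_gt0 (n m : nat) (sigma : R) (f : R -> R) (e : nat -> R) :
  n = (2 * m)%N -> (0 < m)%N -> 0 < sigma ->
  e 2%N - e 1%N != (f (1 / n%:R) - f (2 / n%:R)) / sigma ->
  0 < sigma02_hat n (reg_obs n sigma f e).
Proof.
move=> nm m0 s0 He; have nR : 0 < n%:R :> R by rewrite ltr0n nm; lia.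
have e2 : n./2 = m by rewrite nm mul2n doubleK.
rewrite /sigma02_hat /sigma2_hat e2 divr_gt0// mulr_gt0 ?invr_gt0//.
rewrite big_ltn//; apply: ltr_pwDl; last first.
  by apply: sumr_ge0 => i _; exact: sqr_ge0.
rewrite lt_neqAle sqr_ge0 andbT eq_sym sqrf_eq0 muln1 /= /reg_obs.
apply: contra_neq He => h; apply: (mulIf (lt0r_neq0 s0)).
by rewrite divfK ?gt_eqF//; lra.
Qed.

(** The gap statistic dominates the chord gap of the data, which is the chord
    gap of the signal up to a noise term of order sigma x sqrt (j - i). *)
Lemma S_reg_gt (n m : nat) (sigma K x r : R) (f : R -> R) (e : nat -> R) i k j :
  n = (2 * m)%N -> (0 < m)%N -> 0 < sigma -> 0 <= x -> 0 <= K -> 0 <= r ->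
  (i < k < j)%N -> (j <= m)%N ->
  (forall a b, (a < b <= m)%N -> `|partial_sum (epsbar e) b - partial_sum (epsbar e) a|
      <= x * Num.sqrt (b - a)%:R) ->
  0 < sigma02_hat n (reg_obs n sigma f e) <= (K * sigma) ^+ 2 ->
  (r * K + x) * sigma * Num.sqrt (j - i)%:R <
    chord_gap (partial_sum (fbar n f)) i k j ->
  r < S_reg n (reg_obs n sigma f e) (i%:R / m%:R) (j%:R / m%:R).
Proof.
move=> nm m0 s0 x0 K0 r0 ikj jm He /andP[v0 vK] Hd.
have mR : 0 < m%:R :> R by rewrite ltr0n.
have e2 : n./2 = m by rewrite nm mul2n doubleK.
rewrite /S_reg e2; set Y := reg_obs n sigma f e; set v := sigma02_hat n Y in v0 vK *.
have ij : (i < j)%N by case/andP: ikj => /ltn_trans /[apply].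
have d0 : 0 < Num.sqrt (j - i)%:R :> R by rewrite sqrtr_gt0 ltr0n subn_gt0.
have sv0 : 0 < Num.sqrt v by rewrite sqrtr_gt0.
have svK : Num.sqrt v <= K * sigma.
  rewrite -[leRHS]ger0_norm; last by rewrite mulr_ge0// ltW.
  by rewrite -sqrtr_sqr ler_wsqrtr.
rewrite invfM mulrA [m%:R / v]mulrC -mulrA sqrtrM ?invr_ge0 ?(ltW v0)// sqrt_grid//.
rewrite sqrtrV ?(ltW v0)//.
have G := chord_gap_le_sup_gap (Ybar Y) m0 ikj.
set g := sup_gap _ _ _ in G *.
have noise : - (x * Num.sqrt (j - i)%:R) <= chord_gap (partial_sum (epsbar e)) i k j.
  apply: chord_gap_ge => // a b /andP[ab bj]; apply: He.
  by rewrite ab (leq_trans bj).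
have E : chord_gap (partial_sum (Ybar Y)) i k j =
    chord_gap (partial_sum (fbar n f)) i k j +
    sigma / Num.sqrt 2 * chord_gap (partial_sum (epsbar e)) i k j.
  by rewrite -chord_gapD; congr chord_gap; apply/funext => l; exact: partial_sum_reg_obs.
have s2 : 0 < sigma / Num.sqrt 2 by rewrite divr_gt0// sqrtr_gt0.
have s2s : sigma / Num.sqrt 2 <= sigma.
  by rewrite ler_pdivrMr ?sqrtr_gt0// ler_peMr ?(ltW s0)// -{1}sqrtr1 ler_wsqrtr// ler1n.
set D := Num.sqrt (j - i)%:R in Hd d0 noise *.
have xD : 0 <= x * D by rewrite mulr_ge0// ltW.
have h1 : r * K * sigma * D < chord_gap (partial_sum (Ybar Y)) i k j.
  rewrite E; nra.
have h2 : r * Num.sqrt v * D < g * m%:R.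
  rewrite -ltr_pdivrMr//; apply: lt_le_trans G; rewrite ltr_pM2r ?invr_gt0//.
  apply: le_lt_trans h1; rewrite ler_pM2r// -mulrA ler_wpM2l//.
have -> : (Num.sqrt v)^-1 * (m%:R / D) * g = g * m%:R / (Num.sqrt v * D).
  by rewrite invfM; lra.
by rewrite ltr_pdivlMr ?mulr_gt0// mulrA.
Qed.

End power.

Lemma le_max_grid (R : realType) (m i j : nat) (S : R -> R -> R) :
  (i < j)%N -> (j <= m)%N ->
  S (i%:R / m%:R) (j%:R / m%:R) <= max_grid m S.
Proof.
move=> ij jm; have im' : (i < m.+1)%N by lia.
have jm' : (j < m.+1)%N by lia.
by apply: (bigmax_sup (Ordinal im', Ordinal jm')).
Qed.

Section power_of_test.
Context d (T : measurableType d) (R : realType) (P : probability T R).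

(** Outside an event of probability beta / 2 the sum of the squared noises is
    at most 16 n / beta, and then the estimated standard deviation is at most
    sigma times this constant. *)
Definition variance_ratio (beta : R) : R := Num.sqrt (1 / 2 + 32 / beta).

(** The test rejects unless the noise fluctuates too much, the squared noises
    are too large, or the first two observations coincide; the last event has
    probability 0. *)
Lemma reject_prob_ge (n m : nat) (eps : nat -> {RV P >-> R}) (sigma beta r rb : R)
    (f : R -> R) (i k j : nat) :
  n = (2 * m)%N -> (0 < m)%N -> iid_standard_gaussian n eps ->
  0 < sigma -> 0 < beta < 1 -> r <= rb -> 0 <= rb ->
  (forall l, (1 <= l <= m)%N ->
     `|f ((2 * l)%:R / n%:R) - f ((2 * l).-1%:R / n%:R)| <= sigma) ->
  (i < k < j)%N -> (j <= m)%N ->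
  (rb * variance_ratio beta + noise_level n (beta / 2)) * sigma *
    Num.sqrt (j - i)%:R < chord_gap (partial_sum (fbar n f)) i k j ->
  ((1 - beta)%:E <= reject_prob P n eps sigma f (@T_reg R n r))%E.
Proof.
move=> nm m0 iid s0 /andP[b0 b1] rrb rb0 Hf ikj jm Hd.
have n0 : (0 < n)%N by rewrite nm; lia.
have n1 : (1 < n)%N by rewrite nm; lia.
have e2 : n./2 = m by rewrite nm mul2n doubleK.
have b2 : 0 < beta / 2 <= 1 by apply/andP; split; lra.
have [Bad [mBad PBad good]] := noise_fluctuation iid nm m0 b2.
have bb0 : 0 < beta / 2 by lra.
have PVar := sum_sqr_tail n0 iid bb0.
set Var := [set w | _] in PVar.
pose c := (f (1 / n%:R) - f (2 / n%:R)) / sigma.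
pose Tie := [set w | eps 2%N w - eps 1%N w = c].
have [indep gauss] := iid.
have PTie : P Tie = 0%E.
  have i12 : independent2 P (eps 1%N) (eps 2%N).
    by apply: (@mutually_independent_pair _ _ _ _ n 1 2 eps indep); rewrite ?n0 ?n1.
  apply: (@prob_difference_eq0 _ _ _ P (eps 1%N) (eps 2%N)) => // y.
  exact: normal_no_atom (gauss 2%N n1).
have mVar : measurable Var.
  apply: measurable_le_set => //; apply: measurable_sum => l.
  exact: measurable_funX.
have mTie : measurable Tie.
  by apply: measurable_eq_set; exact: measurable_funB.
rewrite /reject_prob; apply: (@prob_ge_of_good _ _ _ P _ ((Bad `|` Var) `|` Tie)).
- apply: measurable_lt_set => //.
  apply: (@measurable_max_S_reg _ _ _ n (fun l w => reg_obs n sigma f (eps ^~ w) l)) => l.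
  by apply: measurable_funD => //; exact: measurable_funM.
- by apply: measurableU => //; exact: measurableU.
- move=> w /= nB.
  have gw := good w (fun h => nB (or_introl (or_introl h))).
  have nVar : ~ Var w by move=> h; apply: nB; left; right.
  have nTie : ~ Tie w by move=> h; apply: nB; right.
  set e := eps ^~ w in gw *.
  have v0 : 0 < sigma02_hat n (reg_obs n sigma f e).
    by apply: sigma02_hat_gt0 nm m0 s0 _; apply/eqP.
  have K2 : variance_ratio beta ^+ 2 = 1 / 2 + 32 / beta.
    by rewrite sqr_sqrtr// addr_ge0// divr_ge0// ltW.
  have vK : sigma02_hat n (reg_obs n sigma f e) <= (variance_ratio beta * sigma) ^+ 2.
    rewrite exprMn K2.
    have -> : 32 / beta = 2 * (8 / (beta / 2)) by rewrite invf_div; lra.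
    apply: sigma02_hat_le nm m0 s0 Hf _.
    by move/negP: nVar; rewrite -ltNge => /ltW.
  have ij : (i < j)%N by case/andP: ikj => /ltn_trans /[apply].
  have S := S_reg_gt nm m0 s0 (sqrtr_ge0 _) (sqrtr_ge0 _) rb0 ikj jm gw
    (introT andP (conj v0 vK)) Hd.
  rewrite /T_reg /=; apply: (le_lt_trans rrb); apply: (lt_le_trans S).
  by rewrite e2; exact: le_max_grid.
- apply: (le_trans (measureU2 _ _ _)) => //; first exact: measurableU.
  rewrite [X in (_ + X)%E]PTie adde0; apply: (le_trans (measureU2 _ _ _)) => //.
  have -> : beta%:E = ((beta / 2)%:E + (beta / 2)%:E)%E.
    by rewrite -EFinD; congr EFin; lra.
  exact: leeD.
Qed.

End power_of_test.

(** * Chord gaps of a regression function *)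

Section detection.
Context (R : realType).

(** The condition under which no grid interval reveals an increase of f; the
    rest of the proof shows that it forces f to be close to nonincreasing. *)
Definition small_gaps (tau : R) (n m : nat) (f : R -> R) : Prop :=
  forall i k j, (i < k < j)%N -> (j <= m)%N ->
    chord_gap (partial_sum (fbar n f)) i k j <= tau * Num.sqrt (j - i)%:R.

Lemma fbar_mean (n m : nat) (f : R -> R) (l : nat) (a b : R) :
  n = (2 * m)%N -> (0 < m)%N -> (0 < l)%N ->
  a <= m%:R^-1 * (l%:R - 1) -> m%:R^-1 * l%:R <= b ->
  exists x y, [/\ a <= x <= b, a <= y <= b & fbar n f l = (f x + f y) / 2].
Proof.
move=> nm m0 l0 al lb; have mR : 0 < m%:R :> R by rewrite ltr0n.
have nE : n%:R = 2 * m%:R :> R by rewrite nm natrM.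
have l2E : (2 * l).-1%:R = 2 * l%:R - 1 :> R.
  by rewrite -subn1 natrB ?natrM// muln_gt0.
have e1 : (2 * l)%:R / n%:R = m%:R^-1 * l%:R :> R.
  by rewrite natrM nE invfM mulrACA divff ?mul1r 1?mulrC// pnatr_eq0.
have e2 : (2 * l).-1%:R / n%:R = m%:R^-1 * l%:R - 1 / 2 * m%:R^-1 :> R.
  by rewrite l2E nE invfM; lra.
have im : 0 < m%:R^-1 :> R by rewrite invr_gt0.
exists ((2 * l).-1%:R / n%:R), ((2 * l)%:R / n%:R); split => //.
  by rewrite e2; apply/andP; split; lra.
by rewrite e1; apply/andP; split; lra.
Qed.

Lemma exists_nat_ge (x : R) : 0 <= x -> exists i : nat, x <= i%:R < x + 1.
Proof.
move=> x0; have /andP[h1 h2] := truncn_itv x0.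
have [e|ne] := eqVneq x (Num.truncn x)%:R.
  by exists (Num.truncn x); rewrite -e; lra.
exists (Num.truncn x).+1; rewrite (ltW h2) /= -natr1 ltrD2r.
by rewrite lt_neqAle eq_sym ne.
Qed.

Lemma grid_level_rise (tau A B : R) (n m i p N : nat) (f : R -> R) :
  n = (2 * m)%N -> (0 < m)%N -> 0 <= tau -> small_gaps tau n m f ->
  (0 < p <= N)%N -> (i + N <= m)%N ->
  (forall x, m%:R^-1 * i%:R <= x <= m%:R^-1 * (i%:R + p%:R) -> f x <= A) ->
  (forall x, m%:R^-1 * (i%:R + N%:R - p%:R) <= x <= m%:R^-1 * (i%:R + N%:R) ->
     B <= f x) ->
  (B - A) * Num.sqrt p%:R <= 24 * tau.
Proof.
move=> nm m0 t0 sg pN Nm fA fB.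
have im : 0 <= m%:R^-1 :> R by rewrite invr_ge0.
have /andP[p0 pN'] := pN.
apply: (level_rise_of_small_chord_gaps (z := fbar n f) (i := i) (N := N)) => //
  [l /andP[il lp]|l /andP[il lp]|i' k j _ ikj jN].
- have h1 : i%:R + 1 <= l%:R :> R by rewrite natr1 ler_nat.
  have h2 : l%:R <= i%:R + p%:R :> R by rewrite -natrD ler_nat.
  have [|x [y [/fA fx /fA fy ->]]] := fbar_mean f nm m0 (leq_ltn_trans (leq0n _) il)
    (a := m%:R^-1 * i%:R) _ (ler_wpM2l im h2).
    by rewrite ler_wpM2l//; lra.
  lra.
- have h1 : i%:R + N%:R - p%:R + 1 <= l%:R :> R.
    by rewrite -natrD -natrB ?natr1 ?ler_nat//; lia.
  have h2 : l%:R <= i%:R + N%:R :> R by rewrite -natrD ler_nat.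
  have [|x [y [/fB fx /fB fy ->]]] := fbar_mean f nm m0 (leq_ltn_trans (leq0n _) il)
    (a := m%:R^-1 * (i%:R + N%:R - p%:R)) _ (ler_wpM2l im h2).
    by rewrite ler_wpM2l//; lra.
  lra.
- by apply: sg => //; exact: leq_trans Nm.
Qed.

(** The grid points between a and b; at most one cell is lost at each end. *)
Lemma grid_approx (m : nat) (a b : R) : (0 < m)%N -> 0 <= a -> a <= b -> b <= 1 ->
  2 <= m%:R * (b - a) ->
  exists i N, [/\ (i + N <= m)%N, a <= m%:R^-1 * i%:R,
    m%:R^-1 * (i%:R + N%:R) <= b, i%:R < m%:R * a + 1 &
    m%:R * b < i%:R + N%:R + 1].
Proof.
move=> m0 a0 ab b1 mab; have mR : 0 < m%:R :> R by rewrite ltr0n.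
have ma0 : 0 <= m%:R * a by rewrite mulr_ge0// ltW.
have [i /andP[ai ia]] := exists_nat_ge ma0.
have mb0 : 0 <= m%:R * b by rewrite mulr_ge0 ?(ltW mR)//; lra.
have /andP[jb bj] := truncn_itv mb0; set j := Num.truncn _ in jb bj.
rewrite -natr1 in bj.
have ij : (i <= j)%N by rewrite -(ler_nat R); lra.
exists i, (j - i)%N; rewrite subnKC// -natrD subnKC//; split => //.
- by rewrite -(ler_nat R) (le_trans jb)// ler_piMr// ltW.
- by rewrite -(ler_pM2l mR) mulrA mulfV ?mul1r// gt_eqF.
- by rewrite -(ler_pM2l mR) mulrA mulfV ?mul1r// gt_eqF.
Qed.

(** The discrete estimate in continuous form: a rise from below A on a window
    of width w to above B on a later one is at most of order
    tau / sqrt (m w). *)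
Lemma level_rise_le (tau w A B : R) (n m : nat) (f : R -> R) (u v : R) :
  n = (2 * m)%N -> (0 < m)%N -> 0 <= tau -> small_gaps tau n m f ->
  0 <= u -> v <= 1 -> 2 * w <= v - u -> 4 <= m%:R * w ->
  (forall x, u <= x <= u + w -> f x <= A) ->
  (forall x, v - w <= x <= v -> B <= f x) ->
  A <= B -> (B - A) * Num.sqrt (m%:R * w / 2) <= 24 * tau.
Proof.
move=> nm m0 t0 sg u0 v1 wv mw fA fB AB.
have mR : 0 < m%:R :> R by rewrite ltr0n.
have w0 : 0 < w by rewrite -(pmulr_rgt0 _ mR); lra.
have mwv : 2 * (m%:R * w) <= m%:R * v - m%:R * u.
  by rewrite -mulrBr mulrCA ler_wpM2l// ltW.
have [||i [N [iNm ui jv iu vj]]] := @grid_approx m u v m0 u0 _ v1; [lra|lra|].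
have mw2 : 0 <= m%:R * w - 2 by lra.
have [p /andP[wp pw]] := exists_nat_ge mw2.
have p0 : (0 < p)%N by rewrite -(ltr_nat R); lra.
have pN : (p <= N)%N by rewrite -(ler_nat R); lra.
have unscale (x y : R) : x <= m%:R * y -> m%:R^-1 * x <= y.
  by move=> h; rewrite -(ler_pM2l mR) mulrA mulfV ?mul1r// gt_eqF.
have unscale' (x y : R) : m%:R * y <= x -> y <= m%:R^-1 * x.
  by move=> h; rewrite -(ler_pM2l mR) mulrA mulfV ?mul1r// gt_eqF.
apply: (@le_trans _ _ ((B - A) * Num.sqrt p%:R)).
  by rewrite ler_wpM2l ?subr_ge0// ler_wsqrtr//; lra.
apply: (@grid_level_rise tau A B n m i p N f) => //; first by rewrite p0.
- move=> x /andP[x1 x2]; apply: fA; rewrite (le_trans ui x1) /=.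
  by apply: (le_trans x2); apply: unscale; lra.
- move=> x /andP[x1 x2]; apply: fB; rewrite (le_trans x2 jv) andbT.
  by apply: le_trans x1; apply: unscale'; lra.
Qed.

(** On an interval where f has slope at least M, the first and the last third
    differ by a level of order M w; cutting in thirds rather than in windows of
    a fixed width keeps a nonempty window on intervals of only three cells. *)
Lemma slope_le (tau w M a : R) (n m : nat) (f : R -> R) :
  n = (2 * m)%N -> (0 < m)%N -> 0 <= tau -> small_gaps tau n m f ->
  0 <= a -> a + w <= 1 -> 4 <= m%:R * w -> 0 <= M ->
  (forall x y, a <= x -> x <= y -> y <= a + w -> M * (y - x) <= f y - f x) ->
  M * (w / 12) * Num.sqrt (m%:R * w / 12) <= 24 * tau.
Proof.
move=> nm m0 t0 sg a0 aw1 mw M0 Hf.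
have mR : 0 < m%:R :> R by rewrite ltr0n.
have w0 : 0 < w by rewrite -(pmulr_rgt0 _ mR); lra.
have [||i [N [iNm ai jb ia bj]]] := @grid_approx m a (a + w) m0 a0 _ aw1; [lra|lra|].
have N3 : (2 < N)%N by rewrite -(ltr_nat R); lra.
pose p := (N %/ 3)%N.
have [p0 pN p3 p6] :
    [/\ (0 < p)%N, (p <= N)%N, (3 * p <= N)%N & (N <= 6 * p)%N].
  by rewrite /p; clear -N3; split; lia.
have p3R : 3 * p%:R <= N%:R :> R by rewrite -natrM ler_nat.
have p6R : N%:R <= 6 * p%:R :> R by rewrite -natrM ler_nat.
have im : 0 <= m%:R^-1 :> R by rewrite invr_ge0.
have pR0 : 0 <= p%:R :> R by [].
have NR0 : 0 <= N%:R :> R by [].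
have mono x y : x <= y -> m%:R^-1 * x <= m%:R^-1 * y by exact: ler_wpM2l.
have nd x y : a <= x -> x <= y -> y <= a + w -> f x <= f y.
  by move=> h1 h2 h3; have := Hf x y h1 h2 h3; have : 0 <= M * (y - x);
    [rewrite mulr_ge0// subr_ge0|lra].
pose x1 : R := m%:R^-1 * (i%:R + p%:R).
pose x2 : R := m%:R^-1 * (i%:R + N%:R - p%:R).
have ax1 : a <= x1 by apply: (le_trans ai); apply: mono; lra.
have x12 : x1 <= x2 by apply: mono; lra.
have x2b : x2 <= a + w by apply: le_trans jb; apply: mono; lra.
have H : (f x2 - f x1) * Num.sqrt p%:R <= 24 * tau.
  apply: (@grid_level_rise tau _ _ n m i p N f) => //; first by rewrite p0.
  - move=> x /andP[h1 h2]; apply: nd => //; first exact: le_trans h1.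
    exact: le_trans x2b.
  - move=> x /andP[h1 h2]; apply: nd => //; first exact: le_trans x12.
    exact: le_trans jb.
have wp : w / 12 <= x2 - x1.
  have : x2 - x1 = m%:R^-1 * (N%:R - 2 * p%:R) by rewrite /x1 /x2; lra.
  move=> ->; rewrite -(ler_pM2l mR) [leRHS]mulrA mulfV ?gt_eqF// mul1r; lra.
apply: le_trans H; apply: ler_pM; rewrite ?sqrtr_ge0//.
- by rewrite mulr_ge0// divr_ge0// ltW.
- apply: le_trans (Hf _ _ ax1 x12 x2b); exact: ler_wpM2l.
- by rewrite ler_wsqrtr//; lra.
Qed.

End detection.

(** * The criteria and the one-sided derivative on the unit interval *)

Section function_classes.
Context (R : realType).
Implicit Types (f : R -> R).

(** The function t |-> sup of f on [t, 1] is nonincreasing and lies above f by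
    at most the largest rise of f. *)
Lemma Delta1_rise f (rho M : R) : 0 < rho ->
  (forall t, 0 <= t <= 1 -> `|f t| <= M) ->
  (rho%:E <= Delta1 f)%E ->
  exists u v, [/\ 0 <= u, u <= v, v <= 1 & rho / 2 <= f v - f u].
Proof.
move=> rho0 fM rhoD; apply: contrapT => H.
have small u v : 0 <= u -> u <= v -> v <= 1 -> f v - f u <= rho / 2.
  move=> u0 uv v1; rewrite leNgt; apply/negP => h; apply: H; exists u, v.
  by split => //; exact: ltW.
pose A t := [set f v | v in [set v | t <= v <= 1]].
have ubA t : 0 <= t -> has_ubound (A t).
  move=> t0; exists M => _ [v /andP[tv v1] <-].
  by apply: le_trans (ler_norm _) (fM v _); rewrite v1 (le_trans t0).
pose g t := sup (A t).
have gD : nonincreasing01 g.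
  move=> s t; rewrite !in_itv /= => /andP[s0 s1] /andP[t0 t1] st.
  apply: ge_sup; first by exists (f t), t; rewrite //= lexx.
  move=> _ [v /andP[tv v1] <-]; apply: ub_le_sup; first exact: ubA.
  by exists v; rewrite //= v1 (le_trans st).
have : (Delta1 f <= (rho / 2)%:E)%E.
  apply: (@le_trans _ _ (sup_norm01 (f \- g))).
    by apply: ereal_inf_lbound; exists g.
  apply: ub_ereal_sup => _ [t + <-]; rewrite /= in_itv /= => /andP[t0 t1].
  rewrite lee_fin distrC ger0_norm.
    rewrite lerBlDr; apply: ge_sup; first by exists (f t), t; rewrite //= lexx.
    by move=> _ [v /andP[tv v1] <-]; have := small t v t0 tv v1; lra.
  rewrite subr_ge0; apply: ub_le_sup; first exact: ubA.
  by exists t; rewrite //= lexx.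
by move=> /(le_trans rhoD); rewrite lee_fin; lra.
Qed.

Lemma Delta2_slope f (rho : R) : 0 < rho -> (rho%:E <= Delta2 f)%E ->
  exists2 t, 0 <= t <= 1 & rho / 2 <= derive01 f t.
Proof.
move=> rho0 rhoD; apply: contrapT => H.
have : (Delta2 f <= (rho / 2)%:E)%E.
  apply: ub_ereal_sup => _ [t + <-]; rewrite /= in_itv /= => t01.
  rewrite lee_fin leNgt; apply/negP => h; apply: H; exists t => //; exact: ltW.
by move=> /(le_trans rhoD); rewrite lee_fin; lra.
Qed.

Lemma sup_norm01_le f (L : R) : (sup_norm01 f <= L%:E)%E ->
  forall t, 0 <= t <= 1 -> `|f t| <= L.
Proof.
move=> fL t t01; rewrite -lee_fin; apply: le_trans fL.
by apply: ereal_sup_ubound; exists t; rewrite //= in_itv.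
Qed.

(** At the end points as well, the limit of the restricted difference quotient
    gives a first-order expansion on [0, 1]; continuity on [0, 1] and, inside,
    differentiability follow from it. *)
Lemma derive01_expansion f (x e : R) : differentiable01 f -> 0 <= x <= 1 -> 0 < e ->
  exists2 del, 0 < del & forall y, 0 <= y <= 1 -> `|y - x| < del ->
    `|f y - f x - derive01 f x * (y - x)| <= e * `|y - x|.
Proof.
move=> df x01 e0; have xI : x \in `[0, 1] by rewrite in_itv.
have /cvgrPdist_le /(_ e e0) := df x xI.
move=> /nbhs_ballP [del /= del0 H]; exists del => // y y01 yx.
have [->|yx0] := eqVneq y x; first by rewrite !subrr mulr0 subr0 normr0 mulr0.
have d0 : 0 < `|y - x| by rewrite normr_gt0 subr_eq0.
have := H y; rewrite /ball /= distrC => /(_ yx yx0); rewrite in_itv /= => /(_ y01).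
rewrite -/(derive01 f x) -(ler_pM2r d0) -normrM mulrBl divfK ?subr_eq0//.
by rewrite distrC.
Qed.

Lemma derive01_continuous f (a b : R) : differentiable01 f -> 0 <= a -> b <= 1 ->
  {within `[a, b], continuous f}.
Proof.
move=> df a0 b1; apply/subspace_continuousP => x /=; rewrite in_itv /= => /andP[ax xb].
apply/cvgrPdist_le => e e0.
have x01 : 0 <= x <= 1 by rewrite (le_trans a0) ?(le_trans xb).
have [del del0 H] := derive01_expansion df x01 ltr01.
pose C := 1 + `|derive01 f x|; have C0 : 0 < C by rewrite ltr_pwDl.
apply/nbhs_ballP; exists (Num.min del (e / C)); first by rewrite /= lt_min del0 divr_gt0.
move=> y; rewrite /ball /= lt_min distrC => /andP[yd ye]; rewrite in_itv /= => /andP[ay yb].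
have := H y; rewrite (le_trans a0 ay) (le_trans yb b1) => /(_ isT yd) h.
rewrite distrC; apply: (@le_trans _ _ (C * `|y - x|)).
  have -> : f y - f x = (f y - f x - derive01 f x * (y - x)) + derive01 f x * (y - x) by lra.
  by apply: (le_trans (ler_normD _ _)); rewrite normrM /C mulrDl lerD.
by rewrite mulrC -ler_pdivlMr// ltW.
Qed.

Lemma derive01_is_derive f (x : R) : differentiable01 f -> 0 < x < 1 ->
  is_derive x 1 f (derive01 f x).
Proof.
move=> df /andP[x0 x1].
have x01 : 0 <= x <= 1 by rewrite !ltW.
suff H : h^-1 *: (f (h *: 1 + x) - f x) @[h --> 0^'] --> derive01 f x.
  by apply: DeriveDef; [apply/cvg_ex; exists (derive01 f x)|exact: cvg_lim].
apply/cvgrPdist_le => e e0.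
have [del del0 H] := derive01_expansion df x01 e0.
apply/nbhs_ballP; exists (Num.min del (Num.min x (1 - x))).
  by rewrite /= !lt_min del0 x0 subr_gt0.
move=> h; rewrite /ball /= sub0r normrN !lt_min => /and3P[hd hx h1] hn0.
have := H (h + x); rewrite addrK hd.
have /andP[h2 h3] : - x <= h <= x by rewrite -ler_norml ltW.
have /andP[h4 h5] : - (1 - x) <= h <= 1 - x by rewrite -ler_norml ltW.
have -> : 0 <= h + x <= 1 by apply/andP; split; lra.
move=> /(_ isT isT) {}H.
have hn : 0 < `|h| by rewrite normr_gt0.
rewrite -(ler_pM2r hn) -normrM; apply: le_trans H.
rewrite -normrN /GRing.scale /= mulr1 mulrBl mulrAC mulVf// mul1r.
by rewrite opprB.
Qed.

Lemma derive01_MVT f (x y : R) : differentiable01 f -> 0 <= x -> x < y -> y <= 1 ->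
  exists2 c, x <= c <= y & f y - f x = derive01 f c * (y - x).
Proof.
move=> df x0 xy y1.
have dd c : c \in `]x, y[ -> is_derive c 1 f (derive01 f c).
  rewrite in_itv /= => /andP[xc cy]; apply: derive01_is_derive => //.
  by rewrite (le_lt_trans x0 xc) (lt_le_trans cy y1).
have [c cxy ->] := MVT xy dd (derive01_continuous df x0 y1).
by exists c => //; move: cxy; rewrite in_itv /= => /andP[/ltW -> /ltW ->].
Qed.

Lemma derive01_le_rise f (M x y : R) : differentiable01 f ->
  0 <= x -> x <= y -> y <= 1 ->
  (forall t, x <= t <= y -> derive01 f t <= M) -> f y - f x <= M * (y - x).
Proof.
move=> df x0; rewrite le_eqVlt => /orP[/eqP <- _ _|xy y1 H]; first by rewrite !subrr mulr0.
have [c cxy ->] := derive01_MVT df x0 xy y1.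
by rewrite ler_wpM2r ?H// subr_ge0 ltW.
Qed.

Lemma derive01_ge_rise f (M x y : R) : differentiable01 f ->
  0 <= x -> x <= y -> y <= 1 ->
  (forall t, x <= t <= y -> M <= derive01 f t) -> M * (y - x) <= f y - f x.
Proof.
move=> df x0; rewrite le_eqVlt => /orP[/eqP <- _ _|xy y1 H]; first by rewrite !subrr mulr0.
have [c cxy ->] := derive01_MVT df x0 xy y1.
by rewrite ler_wpM2r ?H// subr_ge0 ltW.
Qed.

Lemma derive01_lipschitz f (L x y : R) : differentiable01 f ->
  (forall t, 0 <= t <= 1 -> `|derive01 f t| <= L) ->
  0 <= x <= 1 -> 0 <= y <= 1 -> `|f x - f y| <= L * `|x - y|.
Proof.
move=> df fL; wlog xy : x y / x <= y => [H x01 y01|].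
  have [xy|/ltW yx] := leP x y; first exact: H.
  by rewrite distrC [`|x - y|]distrC H.
move=> /andP[x0 _] /andP[_ y1]; rewrite distrC [`|x - y|]distrC.
rewrite [`|y - x|]ger0_norm ?subr_ge0// ler_norml -mulNr.
have LB t : x <= t <= y -> - L <= derive01 f t <= L.
  by move=> /andP[xt ty]; rewrite -ler_norml fL// (le_trans x0 xt) (le_trans ty).
by rewrite derive01_ge_rise ?derive01_le_rise// => t /LB /andP[].
Qed.

End function_classes.

(** * Rises and slopes at the critical bandwidth *)

Section visible_rises.
Context (R : realType).
Implicit Types (f : R -> R).

Lemma sqrt_div_sqr (x c : R) : 0 <= x -> 0 < c ->
  Num.sqrt x / c = Num.sqrt (x / c ^+ 2).
Proof.
by move=> x0 c0; rewrite sqrtrM// sqrtrV ?sqr_ge0// sqrtr_sqr ger0_norm// ltW.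
Qed.

(** Here g is the separation and h the bandwidth; they are balanced so that a
    rise g over a window of width h has the size q = sigma sqrt (ln n) of the
    noise after normalisation. *)
Lemma rise_not_small (n m : nat) (f : R -> R) (T q g h tau C : R) :
  n = (2 * m)%N -> (0 < m)%N -> 0 <= T -> 0 < q -> 0 < g -> 0 < h ->
  g * Num.sqrt (n%:R * h) = q -> 0 <= tau <= T * q -> small_gaps tau n m f ->
  1200 * (1 + T) <= C ->
  forall u v w e, 0 <= u -> v <= 1 -> 2 * w <= v - u -> 4 <= m%:R * w ->
  h <= w -> 
  (forall x, u <= x <= u + w -> f x <= f u + e) ->
  (forall x, v - w <= x <= v -> f v - e <= f x) ->
  C * g <= f v - f u - 2 * e -> False.
Proof.
move=> nm m0 T0 q0 g0 h0 gq /andP[t0 tT] sg CT u v w e u0 v1 wv mw hw fA fB fvu.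
have mR : 0 < m%:R :> R by rewrite ltr0n.
have C0 : 0 < C by lra.
have Cg0 : 0 < C * g by rewrite mulr_gt0.
have := level_rise_le nm m0 t0 sg u0 v1 wv mw fA fB.
have AB : f u + e <= f v - e by lra.
move=> /(_ AB) H.
have s1 : Num.sqrt (n%:R * h) / 2 <= Num.sqrt (m%:R * w / 2).
  rewrite sqrt_div_sqr ?mulr_ge0 ?(ltW h0)// ler_wsqrtr// nm natrM.
  have : m%:R * h <= m%:R * w by rewrite ler_wpM2l// ltW.
  lra.
have h1 : C * g * (Num.sqrt (n%:R * h) / 2) <= 24 * tau.
  apply: le_trans H; apply: ler_pM => //; rewrite ?(ltW Cg0) ?divr_ge0 ?sqrtr_ge0//.
  lra.
have h2 : C * g * (Num.sqrt (n%:R * h) / 2) = C * q / 2 by rewrite -gq; lra.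
have : 1200 * (1 + T) * q <= C * q by rewrite ler_wpM2r// ltW.
have : 0 <= T * q by rewrite mulr_ge0// ltW.
lra.
Qed.

(** A slope D g / h at t persists, up to a factor 2, on one of the intervals
    [t, t + 2h], [t - 2h, t] by the Hoelder bound on the derivative, and a rise
    of order D g over a width of order h is visible. *)
Lemma slope_not_small (n m : nat) (f : R -> R) (T q g h tau D : R) :
  n = (2 * m)%N -> (0 < m)%N -> 0 <= T -> 0 < q -> 0 < g -> 0 < h ->
  g * Num.sqrt (n%:R * h) = q -> 0 <= tau <= T * q -> small_gaps tau n m f ->
  2 <= m%:R * h -> h <= 1 / 4 -> differentiable01 f ->
  (forall x y, 0 <= x <= 1 -> 0 <= y <= 1 -> `|x - y| <= 2 * h ->
     `|derive01 f x - derive01 f y| <= 2 * (g / h)) ->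
  1200 * (1 + T) <= D ->
  forall t, 0 <= t <= 1 -> derive01 f t <= D * (g / h).
Proof.
move=> nm m0 T0 q0 g0 h0 gq /andP[t0 tT] sg mh h4 df hol DT t /andP[t00 t1].
rewrite leNgt; apply/negP => Dt.
have gh0 : 0 < g / h by rewrite divr_gt0.
have [a [a0 a1 ta]] : exists a, [/\ 0 <= a, a + 2 * h <= 1 & a <= t <= a + 2 * h].
  have [th|th] := leP t (1 / 2).
    by exists t; split; [|lra|rewrite lexx /=; lra].
  by exists (t - 2 * h); split; [lra|lra|apply/andP; split; lra].
have D0 : 1200 <= D by lra.
pose M := D / 2 * (g / h).
have M0 : 0 <= M by rewrite mulr_ge0 ?(ltW gh0)//; lra.
have H := @slope_le R tau (2 * h) M a n m f nm m0 t0 sg a0 a1.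
have mw : 4 <= m%:R * (2 * h) by lra.
have {}H := H mw M0.
have : M * (2 * h / 12) * Num.sqrt (m%:R * (2 * h) / 12) <= 24 * tau.
  apply: H => x y ax xy ya; apply: derive01_ge_rise => //; [lra|lra|].
  move=> z /andP[xz zy]; have z01 : 0 <= z <= 1 by apply/andP; split; lra.
  have t01 : 0 <= t <= 1 by rewrite t00.
  have := hol z t z01 t01; rewrite !ler_norml.
  have -> : - (2 * h) <= z - t <= 2 * h.
    by move: ta => /andP[ta1 ta2]; apply/andP; split; lra.
  move=> /(_ isT) /andP[h1 _]; rewrite /M; move: gh0 Dt h1; set X := g / h; nra.
have s1 : Num.sqrt (n%:R * h) / 4 <= Num.sqrt (m%:R * (2 * h) / 12).
  by rewrite sqrt_div_sqr ?mulr_ge0 ?(ltW h0)// ler_wsqrtr// nm natrM; lra.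
have Mh : M * (2 * h / 12) = D / 12 * g.
  have e : g / h * h = g by rewrite divfK// gt_eqF.
  have := congr1 (fun z => z * (D / 12)) e; rewrite /M; lra.
rewrite Mh => {}H.
have h1 : D / 12 * g * (Num.sqrt (n%:R * h) / 4) <= 24 * tau.
  apply: le_trans H; rewrite ler_wpM2l// mulr_ge0 ?(ltW g0)//; lra.
have h2 : D / 12 * g * (Num.sqrt (n%:R * h) / 4) = D * q / 48 by rewrite -gq; lra.
have : 1200 * (1 + T) * q <= D * q by rewrite ler_wpM2r// ltW.
have : 0 <= T * q by rewrite mulr_ge0// ltW.
lra.
Qed.

Lemma powR_le_mul (c s : R) : 1 <= c -> s <= 1 -> c `^ s <= c.
Proof. by move=> c1 s1; rewrite -[leRHS]powRr1 ?ler_powR//; lra. Qed.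

(** The bandwidth solves h^(1 + 2s) = v / rad^2; the two rates of the theorem
    are rad h^s and rad h^(s-1), and the last identity is the balance between
    signal and noise. All of them are linear in the logarithms of rad and v. *)
Lemma scale_exists (s rad v : R) : 0 < s -> 0 < rad -> 0 < v ->
  exists h, [/\ 0 < h,
    h `^ (1 + 2 * s) = v / rad ^+ 2,
    rad * h `^ s = rad `^ (1 / (1 + 2 * s)) * v `^ (s / (1 + 2 * s)),
    rad * h `^ (s - 1) = rad `^ (3 / (1 + 2 * s)) * v `^ ((s - 1) / (1 + 2 * s)) &
    (rad * h `^ s) ^+ 2 * h = v].
Proof.
move=> s0 rad0 v0; pose A := ln rad; pose V := ln v.
have eA : rad = expR A by rewrite lnK.
have eV : v = expR V by rewrite lnK.
have pw (x y : R) : (expR x) `^ y = expR (y * x).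
  by rewrite /powR gt_eqF ?expR_gt0// expRK.
pose t := (1 + 2 * s)^-1.
have st : (1 + 2 * s) * t = 1 by rewrite mulfV// gt_eqF//; lra.
exists (expR (t * (V - 2 * A))).
rewrite eA eV !pw -!expRM_natl -!expRN -!expRD -/t expR_gt0.
have e1 (x : R) : (1 + 2 * s) * t * x = x by rewrite st mul1r.
split => //.
- by congr expR; have := e1 (V - 2 * A); lra.
- by congr expR; have := e1 A; lra.
- by congr expR; have := e1 A; lra.
- by rewrite expr2 -!expRD; congr expR; have := e1 (V - 2 * A); lra.
Qed.

End visible_rises.

(** * Size of the bandwidth *)

Section bandwidths.
Context (R : realType).
Implicit Types (f : R -> R).

(** The assumption on n gives n >= 9 because ln 2 >= 1 / 2. *)
Lemma sample_size_facts (alpha : R) (n m : nat) : 0 < alpha < 1 ->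
  18 * ln (2 / alpha) <= n%:R -> n = (2 * m)%N ->
  [/\ (1 < m)%N, 1 <= ln (n%:R : R), 0 < ln (m%:R : R),
      ln (m%:R : R) <= ln (n%:R : R) & ln (n%:R : R) <= 2 * ln m%:R].
Proof.
move=> /andP[a0 a1] nln nm.
have ln2 : 1 / 2 <= ln (2 : R).
  have : ln (1 + (- (1 / 2)) : R) <= - (1 / 2) by apply: le_ln1Dx; lra.
  have -> : 1 + (- (1 / 2)) = 2^-1 :> R by lra.
  by rewrite lnV ?posrE//; lra.
have l2a : ln 2 <= ln (2 / alpha).
  by rewrite ler_ln ?posrE ?divr_gt0// ler_pdivlMr//; lra.
have n9 : (8 < n)%N.
  rewrite ltnNge; apply/negP; rewrite -(ler_nat R) => n8.
  have : (9 : R) <= 8 by lra.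
  by rewrite ler_nat.
have m4 : (4 < m)%N by clear -n9 nm; lia.
have m1 : (1 < m)%N by apply: leq_trans m4.
have mR : 0 < m%:R :> R by rewrite ltr0n; apply: leq_trans m4.
have nR : 0 < n%:R :> R by rewrite ltr0n; apply: leq_trans n9.
have m1R : 1 < m%:R :> R by rewrite ltr1n.
have l8 : ln (8 : R) = 3 * ln 2.
  have -> : 8 = 2 * (2 * 2) :> R by lra.
  by rewrite !lnM ?posrE ?mulr_gt0//; lra.
split => //.
- apply: (@le_trans _ _ (ln 8)); first by rewrite l8; lra.
  by rewrite ler_ln ?posrE// ler_nat ltnW.
- exact: ln_gt0.
- by rewrite ler_ln ?posrE// ler_nat nm; clear; lia.
- have -> : 2 * ln m%:R = ln (m%:R * m%:R) :> R by rewrite lnM ?posrE//; lra.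
  rewrite ler_ln ?posrE ?mulr_gt0// -natrM ler_nat nm leq_mul2r.
  by rewrite m1 orbT.
Qed.

Lemma powR_ge1_inv (x p : R) : 0 <= x -> 0 < p -> 1 <= x `^ p -> 1 <= x.
Proof.
move=> x0 p0; apply: contraTT; rewrite -!ltNge => x1.
have -> : 1 = 1 `^ p :> R by rewrite powR1.
by apply: gt0_ltr_powR; rewrite // nnegrE.
Qed.

Lemma powR_le1_inv (x p : R) : 0 <= x -> 0 < p -> x `^ p <= 1 -> x <= 1.
Proof.
move=> x0 p0; apply: contraTT; rewrite -!ltNge => x1.
have -> : 1 = 1 `^ p :> R by rewrite powR1.
by apply: gt0_ltr_powR; rewrite // nnegrE.
Qed.

Lemma mul_powR_div (rad h s : R) : 0 < h ->
  rad * h `^ s / h = rad * h `^ (s - 1).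
Proof.
move=> h0; rewrite -mulrA; congr (_ * _).
have -> : h `^ s = h `^ (s - 1) * h.
  rewrite -[in X in _ * X](powRr1 (ltW h0)) -powRD ?(gt_eqF h0) ?implybT//.
  by rewrite subrK.
by rewrite mulfK// gt_eqF.
Qed.

Lemma powR_1D2 (x s : R) : 0 < x -> x `^ (1 + 2 * s) = x * (x `^ s) ^+ 2.
Proof.
move=> x0; rewrite powRD; last by rewrite (gt_eqF x0) implybT.
rewrite powRr1 ?(ltW x0)//; congr (_ * _).
by rewrite mulrC powRrM -powR_mulrn ?powR_ge0.
Qed.

(** The bound on rad / sigma says that the bandwidth is at least the distance
    between two design points. *)
Lemma bandwidth_ge (s rad sigma h : R) (n : nat) : 0 < s -> 0 < rad ->
  0 < sigma -> (0 < n)%N -> 1 <= ln (n%:R : R) -> 0 < h ->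
  h `^ (1 + 2 * s) = sigma ^+ 2 * ln n%:R / n%:R / rad ^+ 2 ->
  rad / sigma <= n%:R `^ s -> 1 <= n%:R * h.
Proof.
move=> s0 rad0 sg0 n0 l1 h0 hp H; have nR : 0 < n%:R :> R by rewrite ltr0n.
apply: (@powR_ge1_inv _ (1 + 2 * s)); [by rewrite mulr_ge0// ltW|lra|].
rewrite powRM ?(ltW nR) ?(ltW h0)// hp powR_1D2//.
set N := n%:R `^ s in H *.
have N0 : 0 <= N by rewrite powR_ge0.
have rN : rad <= N * sigma by rewrite -ler_pdivrMr.
have rN2 : rad ^+ 2 <= (N * sigma) ^+ 2 by rewrite lerXn2r// nnegrE; nra.
have r2 : 0 < rad ^+ 2 by rewrite exprn_gt0.
rewrite mulrA ler_pdivlMr// mul1r; apply: (le_trans rN2).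
have -> : n%:R * N ^+ 2 * (sigma ^+ 2 * ln n%:R / n%:R) =
   (n%:R / n%:R) * ((N * sigma) ^+ 2 * ln n%:R) by rewrite exprMn; lra.
by rewrite divff ?gt_eqF// mul1r ler_peMr// sqr_ge0.
Qed.

(** The two bounds on rad / sigma say that the bandwidth is between two cells
    and a quarter of [0, 1]: enough cells to see a slope on a width 2h, and
    enough room for such a width on one side of every point. *)
Lemma bandwidth_smooth (s rad sigma h : R) (n m : nat) : 1 < s -> 0 < rad ->
  0 < sigma -> n = (2 * m)%N -> (1 < m)%N -> 0 < ln (m%:R : R) ->
  ln (m%:R : R) <= ln (n%:R : R) -> ln (n%:R : R) <= 2 * ln m%:R ->
  0 < h ->
  h `^ (1 + 2 * s) = sigma ^+ 2 * ln n%:R / n%:R / rad ^+ 2 ->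
  3 `^ (s + 1 / 2) * rad / sigma <= m%:R `^ s * Num.sqrt (ln m%:R) ->
  2 `^ (1 + 2 * s) * Num.sqrt (ln m%:R / m%:R) <= rad / sigma ->
  2 <= m%:R * h /\ h <= 1 / 4.
Proof.
move=> s1 rad0 sg0 nm m1 lm0 lmn lnm h0 hp H3 H2.
have mR : 0 < m%:R :> R by rewrite ltr0n; apply: leq_trans m1.
have nE : n%:R = 2 * m%:R :> R by rewrite nm natrM.
have p0 : 0 < 1 + 2 * s by lra.
set p := 1 + 2 * s in p0 hp H2 *.
have r2 : 0 < rad ^+ 2 by rewrite exprn_gt0.
have s2 : 0 < sigma ^+ 2 by rewrite exprn_gt0.
set a := ln m%:R in lm0 lmn lnm H3 H2 *; set b := ln n%:R in lmn lnm hp *.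
have mm : m%:R / m%:R = 1 :> R by rewrite divff// gt_eqF.
have ss : sigma ^+ 2 / sigma ^+ 2 = 1 by rewrite divff// gt_eqF.
split.
- suff : 1 <= m%:R * h / 2 by lra.
  apply: (@powR_ge1_inv _ p) => //; first by rewrite divr_ge0 ?mulr_ge0// ltW.
  have -> : m%:R * h / 2 = m%:R * (2^-1 * h) by lra.
  rewrite powRM ?mulr_ge0 ?(ltW h0) ?(ltW mR)// powRM ?(ltW h0)//.
  rewrite hp {1}/p powR_1D2//; set M := m%:R `^ s in H3 *.
  have M0 : 0 <= M by rewrite powR_ge0.
  have e3 : (3 `^ (s + 1 / 2)) ^+ 2 = 3 `^ p :> R.
    by rewrite -powR_mulrn ?powR_ge0// -powRrM; congr (_ `^ _); rewrite /p; lra.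
  have h3 : 3 `^ p * rad ^+ 2 <= M ^+ 2 * a * sigma ^+ 2.
    have h3 : 3 `^ (s + 1 / 2) * rad <= M * Num.sqrt a * sigma by rewrite -ler_pdivrMr.
    have -> : M ^+ 2 * a * sigma ^+ 2 = (M * Num.sqrt a * sigma) ^+ 2.
      by rewrite !exprMn sqr_sqrtr// ltW.
    rewrite -e3 -exprMn lerXn2r// nnegrE !mulr_ge0 ?sqrtr_ge0 ?powR_ge0//;
      exact: ltW.
  have e32 : 3 `^ p = (3 / 2) `^ p * 2 `^ p :> R.
    by rewrite -powRM//; congr (_ `^ _); lra.
  have e2i : 2 `^ p * 2^-1 `^ p = 1 :> R by rewrite -powRM// mulfV// powR1.
  have h32 : 2 <= (3 / 2) `^ p :> R.
    apply: (@le_trans _ _ ((3 / 2) `^ 3%:R)); first by rewrite powR_mulrn//; lra.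
    by rewrite ler_powR//; rewrite /p; lra.
  set u := 2^-1 `^ p in e2i *; set w := 2 `^ p in e2i e32.
  set t := (3 / 2) `^ p in e32 h32.
  have u0 : 0 <= u by rewrite powR_ge0.
  have w0 : 0 <= w by rewrite powR_ge0.
  rewrite [X in 1 <= X](_ : _ = u * (M ^+ 2 * sigma ^+ 2 * b / 2) / rad ^+ 2); last first.
    rewrite nE invfM; have := congr1 (fun z => z * (M ^+ 2 * u * sigma ^+ 2 * b / 2 / rad ^+ 2)) mm.
    lra.
  rewrite ler_pdivlMr// mul1r.
  have k1 : t * w * rad ^+ 2 <= M ^+ 2 * b * sigma ^+ 2.
    by rewrite -e32; apply: (le_trans h3); rewrite ler_pM2r// ler_wpM2l ?sqr_ge0.
  have k2 : u * (t * w * rad ^+ 2) <= u * (M ^+ 2 * b * sigma ^+ 2) by exact: ler_wpM2l.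
  have k3 : u * (t * w * rad ^+ 2) = w * u * (t * rad ^+ 2) by lra.
  have k4 : 2 * rad ^+ 2 <= t * rad ^+ 2 by rewrite ler_pM2r.
  move: k2; rewrite k3 e2i mul1r; lra.
- suff : 4 * h <= 1 by lra.
  apply: (@powR_le1_inv _ p) => //; first by rewrite mulr_ge0// ltW.
  rewrite powRM ?(ltW h0)// hp.
  have e4 : 4 `^ p = (2 `^ p) ^+ 2 :> R.
    by rewrite expr2 -powRM//; congr (_ `^ _); lra.
  rewrite e4; set w := 2 `^ p in H2 *.
  have w0 : 0 <= w by rewrite powR_ge0.
  have h2 : w ^+ 2 * (a / m%:R) * sigma ^+ 2 <= rad ^+ 2.
    have am0 : 0 <= a / m%:R by rewrite divr_ge0 ?ltW.
    have h2 : w * Num.sqrt (a / m%:R) * sigma <= rad by rewrite -ler_pdivlMr.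
    have -> : w ^+ 2 * (a / m%:R) * sigma ^+ 2 = (w * Num.sqrt (a / m%:R) * sigma) ^+ 2.
      by rewrite !exprMn sqr_sqrtr.
    rewrite lerXn2r// nnegrE ?(ltW rad0)// !mulr_ge0 ?sqrtr_ge0//; exact: ltW.
  rewrite mulrA ler_pdivrMr// mul1r; apply: le_trans h2.
  rewrite nE invfM.
  have mi : 0 < m%:R^-1 :> R by rewrite invr_gt0.
  have W : 0 <= w ^+ 2 * sigma ^+ 2 * m%:R^-1.
    by rewrite !mulr_ge0 ?sqr_ge0// ltW.
  have : w ^+ 2 * sigma ^+ 2 * m%:R^-1 * (b / 2) <= w ^+ 2 * sigma ^+ 2 * m%:R^-1 * a.
    by rewrite ler_wpM2l//; lra.
  lra.
Qed.

Definition noise_const (eta : R) : R := Num.sqrt (4 + 2 * ln (2 / eta)).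

Lemma noise_level_le (n : nat) (eta : R) : 0 < eta <= 1 -> 1 <= ln (n%:R : R) ->
  noise_level n eta <= noise_const eta * Num.sqrt (ln n%:R).
Proof.
move=> /andP[eta0 eta1] l1.
have l0 : 0 <= ln (2 / eta) by apply: ln_ge0; rewrite ler_pdivlMr//; lra.
rewrite /noise_level /noise_const -sqrtrM; last by lra.
rewrite ler_wsqrtr//; nra.
Qed.

End bandwidths.

(** * Separation rates *)

Lemma reject_of_large_gap d (T : measurableType d) (R : realType)
    (P : probability T R) (n m : nat) (eps : nat -> {RV P >-> R})
    (sigma beta r rb tau : R) (f : R -> R) :
  n = (2 * m)%N -> (0 < m)%N -> iid_standard_gaussian n eps ->
  0 < sigma -> 0 < beta < 1 -> r <= rb -> 0 <= rb ->
  tau = (rb * variance_ratio beta + noise_level n (beta / 2)) * sigma ->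
  (forall x y, 0 <= x <= 1 -> 0 <= y <= 1 -> `|x - y| <= n%:R^-1 ->
     `|f x - f y| <= sigma) ->
  ~ small_gaps tau n m f ->
  ((1 - beta)%:E <= reject_prob P n eps sigma f (@T_reg R n r))%E.
Proof.
move=> nm m0 iid s0 b01 rrb rb0 tauE Hf nsg.
have nR : 0 < n%:R :> R by rewrite ltr0n nm; clear -m0; lia.
have [i [k [j [ikj jm gap]]]] : exists i k j, [/\ (i < k < j)%N, (j <= m)%N &
    tau * Num.sqrt (j - i)%:R < chord_gap (partial_sum (fbar n f)) i k j].
  apply: contrapT => H; apply: nsg => i k j ikj jm; rewrite leNgt; apply/negP => h.
  by apply: H; exists i, k, j.
apply: (reject_prob_ge nm m0 iid s0 b01 rrb rb0 _ ikj jm); last by rewrite -tauE.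
move=> l /andP[l0 lm].
have l2n : (2 * l <= n)%N by rewrite nm leq_mul2l.
have in01 (a : nat) : (a <= n)%N -> 0 <= (a%:R / n%:R : R) <= 1.
  move=> an; apply/andP; split; first by rewrite divr_ge0.
  by rewrite ler_pdivrMr ?mul1r ?ler_nat.
apply: Hf; [exact: in01|apply: in01; exact: leq_trans (leq_pred _) l2n|].
have -> : (2 * l).-1%:R = (2 * l)%:R - 1 :> R by rewrite -subn1 natrB// muln_gt0.
have -> : (2 * l)%:R / n%:R - ((2 * l)%:R - 1) / n%:R = n%:R^-1 :> R by lra.
by rewrite ger0_norm// invr_ge0 ltW.
Qed.

Lemma separation_rate_le d (T : measurableType d) (R : realType)
    (P : probability T R) (n : nat) (eps : nat -> {RV P >-> R})
    (sigma beta rho : R) (Phi : set (nat -> R)) (F : set (R -> R))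
    (Delta : (R -> R) -> \bar R) : 0 < rho ->
  (forall f, F f -> (rho%:E <= Delta f)%E ->
     ((1 - beta)%:E <= reject_prob P n eps sigma f Phi)%E) ->
  (separation_rate P n eps sigma beta Phi F Delta <= rho%:E)%E.
Proof. by move=> rho0 H; apply: ereal_inf_lbound; exists rho. Qed.

Section separation.
Context (R : realType).
Implicit Types (f : R -> R).

Lemma holder_ball_le f (s rad c h x y : R) : 0 < s <= 1 -> 0 < rad -> 0 < h ->
  1 <= c -> holder_ball s rad f -> 0 <= x <= 1 -> 0 <= y <= 1 ->
  `|x - y| <= c * h -> `|f x - f y| <= c * (rad * h `^ s).
Proof.
move=> /andP[s0 s1] rad0 h0 c1 hf x01 y01 xy.
apply: (le_trans (hf x y _ _)); rewrite ?in_itv//.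
rewrite mulrCA ler_wpM2l ?(ltW rad0)//.
apply: (@le_trans _ _ ((c * h) `^ s)).
  by apply: ge0_ler_powR; rewrite ?nnegrE ?(ltW s0)// mulr_ge0 ?(ltW h0)//; lra.
rewrite powRM ?(ltW h0)//; last lra.
by rewrite ler_wpM2r ?powR_ge0// powR_le_mul.
Qed.

(** At scale h the function oscillates by a bounded multiple of g, so a rise
    of 8 D g from u to v forces u and v to be far apart and survives on windows
    of width 8h at both ends. *)
Lemma rough_not_small (n m : nat) f (s rad T q g h tau D : R) :
  n = (2 * m)%N -> (0 < m)%N -> 0 <= T -> 0 < q -> 0 < g -> 0 < h ->
  g * Num.sqrt (n%:R * h) = q -> 0 <= tau <= T * q -> 1200 * (1 + T) <= D ->
  0 < s <= 1 -> 0 < rad -> g = rad * h `^ s -> 1 <= n%:R * h ->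
  holder_ball s rad f -> ((16 * D * g)%:E <= Delta1 f)%E ->
  ~ small_gaps tau n m f.
Proof.
move=> nm m0 T0 q0 g0 h0 gq tT DT s01 rad0 gE nh hf Df sg.
have D0 : 1200 <= D by lra.
have osc c x y : 1 <= c -> 0 <= x <= 1 -> 0 <= y <= 1 -> `|x - y| <= c * h ->
    `|f x - f y| <= c * g.
  by move=> c1 x01 y01 xy; rewrite gE; apply: holder_ball_le xy.
have bounded t : 0 <= t <= 1 -> `|f t| <= `|f 0| + rad.
  move=> /andP[t0 t1]; have -> : f t = (f t - f 0) + f 0 by rewrite subrK.
  rewrite addrC; apply: (le_trans (ler_normD _ _)); rewrite lerD2l//.
  have := @holder_ball_le f s rad 1 1 t 0 s01 rad0 ltr01 (lexx _) hf.
  rewrite powR1 !mulr1 mul1r; apply; rewrite ?lexx ?ler01 ?t0//.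
  by rewrite subr0 ger0_norm.
have rho0 : 0 < 16 * D * g by rewrite mulr_gt0//; move: D0; clear; lra.
have [u [v [u0 uv v1 fuv]]] := Delta1_rise rho0 bounded Df.
have D8 : 1200 * g <= D * g by rewrite ler_pM2r.
have v01 : 0 <= v <= 1 by rewrite (le_trans u0 uv).
have u01 : 0 <= u <= 1 by rewrite u0 (le_trans uv v1).
have wv : 2 * (8 * h) <= v - u.
  rewrite leNgt; apply/negP => vu.
  have vu16 : `|v - u| <= 16 * h.
    by rewrite ger0_norm ?subr_ge0//; move: vu; clear; lra.
  have := osc 16 v u (ltac:(by rewrite ler1n)) v01 u01 vu16.
  by move=> /ler_normlW; move: fuv D8 g0; clear; lra.
have wv' : 8 * h <= v - u by move: wv h0; clear; lra.
have mw : 4 <= m%:R * (8 * h) by move: nh; rewrite nm natrM; clear; lra.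
have hw : h <= 8 * h by move: h0; clear; lra.
have c8 : 1 <= 8 :> R by rewrite ler1n.
apply: (rise_not_small nm m0 T0 q0 g0 h0 gq tT sg DT u0 v1 wv mw hw (e := 8 * g)).
- move=> x /andP[ux xw].
  have x01 : 0 <= x <= 1.
    by rewrite (le_trans u0 ux) /=; move: xw wv' v1; clear; lra.
  have xu8 : `|x - u| <= 8 * h by rewrite ger0_norm ?subr_ge0// lerBlDl.
  by have /ler_normlW := osc 8 x u c8 x01 u01 xu8; rewrite lerBlDl.
- move=> x /andP[vx xv].
  have x01 : 0 <= x <= 1.
    by rewrite (le_trans xv v1) andbT; move: vx wv' u0; clear; lra.
  have vx8 : `|v - x| <= 8 * h.
    by rewrite ger0_norm ?subr_ge0//; move: vx; clear; lra.
  by have /ler_normlW := osc 8 v x c8 v01 x01 vx8; rewrite lerBlDr lerBlDl addrC.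
- by move: fuv D8 g0; clear; lra.
Qed.

(** A large slope is excluded first, which settles the second criterion. With
    the slope bounded by D g / h, f cannot rise by more than 2 D g over a width
    2h, so a rise of 8 D g survives on the windows to the right of u and to
    the left of v. *)
Lemma smooth_not_small (n m : nat) f (s rad L T q g h tau D : R) :
  n = (2 * m)%N -> (0 < m)%N -> 0 <= T -> 0 < q -> 0 < g -> 0 < h ->
  g * Num.sqrt (n%:R * h) = q -> 0 <= tau <= T * q -> 1200 * (1 + T) <= D ->
  1 < s <= 2 -> 0 < rad -> g = rad * h `^ s -> 2 <= m%:R * h -> h <= 1 / 4 ->
  differentiable01 f -> holder_ball (s - 1) rad (derive01 f) ->
  (forall t, 0 <= t <= 1 -> `|derive01 f t| <= L) ->
  ((16 * D * g)%:E <= Delta1 f)%E \/ ((16 * D * (g / h))%:E <= Delta2 f)%E ->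
  ~ small_gaps tau n m f.
Proof.
move=> nm m0 T0 q0 g0 h0 gq tT DT /andP[s1 s2] rad0 gE mh h4 df hf fL Df sg.
have D0 : 1200 <= D by lra.
have gh0 : 0 < g / h by rewrite divr_gt0.
have ghE : g / h = rad * h `^ (s - 1) by rewrite gE mul_powR_div.
have ghh : g / h * h = g by rewrite divfK// gt_eqF.
have slope : forall t, 0 <= t <= 1 -> derive01 f t <= D * (g / h).
  apply: (slope_not_small nm m0 T0 q0 g0 h0 gq tT sg mh h4 df _ DT).
  move=> x y x01 y01 xy; rewrite ghE; apply: holder_ball_le hf x01 y01 xy => //; lra.
case: Df => [Df|Df]; last first.
  have rho0 : 0 < 16 * D * (g / h) by rewrite mulr_gt0//; move: D0; clear; lra.
  have [t t01] := Delta2_slope rho0 Df.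
  have := slope t t01; have : 1200 * (g / h) <= D * (g / h) by rewrite ler_pM2r.
  by move: gh0; clear; lra.
have L0 : 0 <= L by apply: le_trans (fL 0 _); rewrite ?lexx ?ler01.
have bounded t : 0 <= t <= 1 -> `|f t| <= `|f 0| + L.
  move=> t01; have /andP[t0 t1] := t01; have -> : f t = (f t - f 0) + f 0 by rewrite subrK.
  rewrite addrC; apply: (le_trans (ler_normD _ _)); rewrite lerD2l//.
  have z01 : 0 <= (0 : R) <= 1 by rewrite lexx ler01.
  apply: (le_trans (derive01_lipschitz df fL t01 z01)).
  by rewrite subr0 ger0_norm// ler_piMr.
have rho0 : 0 < 16 * D * g by rewrite mulr_gt0//; move: D0; clear; lra.
have [u [v [u0 uv v1 fuv]]] := Delta1_rise rho0 bounded Df.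
have D8 : 1200 * g <= D * g by rewrite ler_pM2r.
have rise x y : 0 <= x -> x <= y -> y <= 1 -> f y - f x <= D * (g / h) * (y - x).
  move=> x0 xy y1; apply: derive01_le_rise => // t /andP[xt ty]; apply: slope.
  by rewrite (le_trans x0 xt) (le_trans ty y1).
have Dgh : 0 < D * (g / h) by rewrite mulr_gt0//; move: D0; clear; lra.
have DghE c : D * (g / h) * (c * h) = c * D * g.
  have := congr1 (fun z => c * D * z) ghh; clear; lra.
have vuh : 8 * h <= v - u.
  rewrite -(ler_pM2l Dgh); apply: le_trans (rise u v u0 uv v1); apply: le_trans fuv.
  by rewrite DghE; clear; lra.
have wv : 2 * (2 * h) <= v - u by move: vuh h0; clear; lra.
have mw : 4 <= m%:R * (2 * h) by move: mh; clear; lra.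
have hw : h <= 2 * h by move: h0; clear; lra.
have near x y : 0 <= x -> x <= y -> y <= 1 -> y - x <= 2 * h -> f y - f x <= 2 * D * g.
  move=> x0 xy y1 yx; apply: (le_trans (rise x y x0 xy y1)).
  by rewrite -DghE ler_pM2l.
apply: (rise_not_small nm m0 T0 q0 g0 h0 gq tT sg DT u0 v1 wv mw hw (e := 2 * D * g)).
- move=> x /andP[ux xw]; have := near u x u0 ux.
  by move: xw vuh h0 v1; clear; lra.
- move=> x /andP[vx xv]; have x0 : 0 <= x by move: vx vuh h0 u0; clear; lra.
  by have := near x v x0 xv v1; move: vx; clear; lra.
- by move: fuv D8 g0; clear; lra.
Qed.

End separation.

Theorem theorem4p2 (R : realType) (s alpha beta : R)
  (hs : 0 < s <= 2) (halpha : 0 < alpha < 1) (hbeta : 0 < beta < 1) :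
  exists C : R, 0 < C /\
  forall (n : nat) (sigma L rad : R)
    (* the noise of the regression model *)
    (d : measure_display) (T : measurableType d) (P : probability T R)
    (eps : nat -> {RV P >-> R})
    (* variables from which the threshold is computed *)
    (d' : measure_display) (T' : measurableType d') (P' : probability T' R)
    (eps' : nat -> {RV P' >-> R}) (X : {RV P' >-> R}),
  (0 < n)%N -> ~~ odd n -> 0 < sigma -> 0 < L -> 0 < rad ->
  18 * ln (2 / alpha) <= n%:R ->
  iid_standard_gaussian n eps ->
  iid_standard_gaussian n eps' ->
  has_chi_square_law n./2 X ->
  independent2 P' (fun w => Z_reg n (fun i => eps' i w)) X ->
  let r := threshold P' n eps' X alpha in
  let rate (F : set (R -> R)) Delta :=
    separation_rate P n eps sigma beta (@T_reg R n r) F Delta in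
  let m := n./2 in
  let v := sigma ^+ 2 * ln n%:R / n%:R in
  (s <= 1 ->
     rad / sigma <= n%:R `^ s ->
     (rate (holder_class s rad) (@Delta1 R) <=
        (C * rad `^ (1 / (1 + 2 * s)) * v `^ (s / (1 + 2 * s)))%:E)%E) /\
  (1 < s ->
     L / sigma <= n%:R ->
     3 `^ (s + 1 / 2) * rad / sigma <= m%:R `^ s * Num.sqrt (ln m%:R) ->
     2 `^ (1 + 2 * s) * Num.sqrt (ln m%:R / m%:R) <= rad / sigma ->
     (rate (holder_class_bdd s rad L) (@Delta1 R) <=
        (C * rad `^ (1 / (1 + 2 * s)) * v `^ (s / (1 + 2 * s)))%:E)%E /\
     (rate (holder_class_bdd s rad L) (@Delta2 R) <=
        (C * rad `^ (3 / (1 + 2 * s)) * v `^ ((s - 1) / (1 + 2 * s)))%:E)%E).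
Proof.
(* T sigma sqrt (ln n) bounds the threshold multiplied by the estimated standard
   deviation, plus the noise; a slope D g / h or a rise D g exceeds it *)
pose T := 2 * expR 1 * noise_const (alpha / 2) * variance_ratio beta +
  noise_const (beta / 2).
pose D := 1200 * (1 + T).
have T0 : 0 <= T.
  by rewrite addr_ge0 ?sqrtr_ge0// !mulr_ge0 ?sqrtr_ge0// expR_ge0.
have D0 : 1200 <= D by rewrite /D; lra.
exists (16 * D); split; first by lra.
move=> n sigma L rad d Om P eps d' Om' P' eps' X n0 nodd s0 L0 rad0 nln iid iid'
  XL _ r rate m v.
have /andP[hs0 hs2] := hs.
have nm : n = (2 * m)%N by rewrite mul2n /m even_halfK.
have [m1 ln1 lm0 lmn lnm] := sample_size_facts halpha nln nm.
have m0 : (0 < m)%N by apply: leq_trans m1.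
have nR : 0 < n%:R :> R by rewrite ltr0n.
have ln0 : 0 < ln n%:R :> R by lra.
pose q := sigma * Num.sqrt (ln n%:R).
have q0 : 0 < q by rewrite mulr_gt0// sqrtr_gt0.
have v0 : 0 < v by rewrite divr_gt0// mulr_gt0// exprn_gt0.
have [h [h0 hp gE E2 gv]] := scale_exists hs0 rad0 v0.
set g := rad * h `^ s in gE gv.
have g0 : 0 < g by rewrite mulr_gt0// powR_gt0.
have gq : g * Num.sqrt (n%:R * h) = q.
  rewrite /q -[g]ger0_norm ?(ltW g0)// -sqrtr_sqr -sqrtrM ?sqr_ge0//.
  rewrite -[sigma in RHS]ger0_norm ?(ltW s0)// -sqrtr_sqr -sqrtrM ?sqr_ge0//.
  by congr Num.sqrt; rewrite mulrCA gv /v mulrC divfK// (gt_eqF nR).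
pose rb := 2 * expR 1 * noise_level n (alpha / 2).
have rrb : r <= rb by exact: threshold_le XL.
have rb0 : 0 <= rb by rewrite !mulr_ge0 ?sqrtr_ge0// expR_ge0.
pose tau := (rb * variance_ratio beta + noise_level n (beta / 2)) * sigma.
have tauT : 0 <= tau <= T * q.
  apply/andP; split.
    by rewrite mulr_ge0 ?(ltW s0)// addr_ge0 ?sqrtr_ge0// mulr_ge0// sqrtr_ge0.
  have a2 : 0 < alpha / 2 <= 1 by move: halpha; clear; lra.
  have b2 : 0 < beta / 2 <= 1 by move: hbeta; clear; lra.
  have ka := noise_level_le a2 ln1; have kb := noise_level_le b2 ln1.
  rewrite /tau /q mulrCA [leLHS]mulrC ler_pM2l// /T mulrDl lerD//.
  by rewrite [leRHS]mulrAC ler_wpM2r ?sqrtr_ge0// -[leRHS]mulrA ler_wpM2l.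
have reject f : (forall x y, 0 <= x <= 1 -> 0 <= y <= 1 -> `|x - y| <= n%:R^-1 ->
     `|f x - f y| <= sigma) -> ~ small_gaps tau n m f ->
  ((1 - beta)%:E <= reject_prob P n eps sigma f (@T_reg R n r))%E.
  move=> Hf nsg; exact: (reject_of_large_gap nm m0 iid s0 hbeta rrb rb0 erefl Hf nsg).
have DT : 1200 * (1 + T) <= D by exact: lexx.
have D16 : 0 < 16 * D by move: D0; clear; lra.
split=> [s1 radn|s1 Ln H3 H2].
- rewrite -mulrA -gE; apply: separation_rate_le; first by rewrite mulr_gt0.
  move=> f; rewrite /holder_class s1 => hf Df.
  have s01 : 0 < s <= 1 by rewrite hs0.
  have nh := bandwidth_ge hs0 rad0 s0 n0 ln1 h0 hp radn.
  apply: reject => [x y x01 y01 xy|].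
    have ni0 : 0 < n%:R^-1 :> R by rewrite invr_gt0.
    have := holder_ball_le (c := 1) s01 rad0 ni0 (lexx _) hf x01 y01.
    rewrite !mul1r => /(_ xy) /le_trans; apply.
    rewrite -powR_inv1 ?(ltW nR)// -powRrM mulN1r powRN ler_pdivrMr ?powR_gt0//.
    by rewrite mulrC -ler_pdivrMr.
  exact: (rough_not_small nm m0 T0 q0 g0 h0 gq tauT DT s01 rad0 erefl nh hf Df).
have s12 : 1 < s <= 2 by rewrite s1.
have [mh h4] := bandwidth_smooth s1 rad0 s0 nm m1 lm0 lmn lnm h0 hp H3 H2.
have ghE : g / h = rad * h `^ (s - 1) by rewrite /g mul_powR_div.
have power f : holder_class_bdd s rad L f ->
    ((16 * D * g)%:E <= Delta1 f)%E \/ ((16 * D * (g / h))%:E <= Delta2 f)%E ->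
    ((1 - beta)%:E <= reject_prob P n eps sigma f (@T_reg R n r))%E.
  rewrite /holder_class_bdd /holder_class /= leNgt s1 /= => -[[df hf] fL] Df.
  have {}fL := sup_norm01_le fL.
  apply: reject => [x y x01 y01 xy|].
    apply: (le_trans (derive01_lipschitz df fL x01 y01)).
    apply: (@le_trans _ _ (L / n%:R)); first by rewrite ler_pM2l.
    by rewrite ler_pdivrMr// mulrC -ler_pdivrMr.
  exact: (smooth_not_small nm m0 T0 q0 g0 h0 gq tauT DT s12 rad0 erefl mh h4 df hf fL Df).
split.
- rewrite -mulrA -gE; apply: separation_rate_le; first by rewrite mulr_gt0.
  by move=> f Ff Df; apply: power => //; left.
- rewrite -mulrA -E2 -ghE; apply: separation_rate_le.
    by rewrite mulr_gt0// divr_gt0.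
  by move=> f Ff Df; apply: power => //; right.
Qed.
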